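(* Let $\Omega\subseteq\mathbb{R}^2$ be an open domain that is star-shaped with respect to the origin, let $\delta\in\mathcal{C}^\infty(\Omega)$ be positive, and let $M=(\Omega,\delta^{-2}(dx^2+dy^2))$. Let $\tau,H\in\mathcal{C}^2(\Omega)$ and let $\Omega'\subseteq\Omega$ be a simply connected open domain. (a) If the graph of a function $f\in\mathcal{C}^2(\Omega')$ in $\mathbb{E}^3(M,\tau)$ has mean curvature $H$ (that is, $H|_{\Omega'}$), then there exists $g\in\mathcal{C}^2(\Omega')$ such that the graph of $g$ is spacelike in $\mathbb{L}^3(M,H)$ and has mean curvature $\tau$. (b) If the graph of a function $g\in\mathcal{C}^2(\Omega')$ in $\mathbb{L}^3(M,H)$ is spacelike and has mean curvature $\tau$, then there exists $f\in\mathcal{C}^2(\Omega')$ such that the graph of $f$ in $\mathbb{E}^3(M,\tau)$ has mean curvature $H$. Moreover, set $$(\alpha,\beta)=\left(f_x+y\,\mathbf{C}_{\delta,\tau},\ f_y-x\,\mathbf{C}_{\delta,\tau}\right),\qquad \omega=\sqrt{1+\delta^2(\alpha^2+\beta^2)},$$ $$(\widetilde\alpha,\widetilde\beta)=\left(g_x-y\,\mathbf{C}_{\delta,H},\ g_y+x\,\mathbf{C}_{\delta,H}\right),\qquad \widetilde\omega=\sqrt{1-\delta^2(\widetilde\alpha^2+\widetilde\beta^2)}.$$ Then the function $g$ in (a) (respectively, $f$ in (b)) can be chosen so that the twin relations hold: $$(\widetilde\alpha,\widetilde\beta)=\left(-\frac{\beta}{\omega},\frac{\alpha}{\omega}\right),\qquad\text{or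 equivalently,}\qquad (\alpha,\beta)=\left(\frac{\widetilde\beta}{\widetilde\omega},-\frac{\widetilde\alpha}{\widetilde\omega}\right).$$ For $f,g$ so related, if the graphs are parametrized by $F(x,y)=(x,y,f(x,y))$ and $G(x,y)=(x,y,g(x,y))$, $(x,y)\in\Omega'$, then the map $F(x,y)\mapsto G(x,y)$ is a conformal diffeomorphism. More explicitly, if $\mathbf{I}_F$ and $\widetilde{\mathbf{I}}_G$ denote the metrics induced on the graphs $z=f(x,y)$ in $\mathbb{E}^3(M,\tau)$ and $z=g(x,y)$ in $\mathbb{L}^3(M,H)$, respectively, then (identifying points via $F(x,y)\mapsto G(x,y)$) $$\widetilde{\mathbf{I}}_G=\frac{1}{\omega^2}\mathbf{I}_F,\qquad\text{or equivalently}\qquad \mathbf{I}_F=\frac{1}{\widetilde\omega^2}\widetilde{\mathbf{I}}_G,\qquad\text{or symmetrically}\qquad \frac1\omega\mathbf{I}_F=\frac{1}{\widetilde\omega}\widetilde{\mathbf{I}}_G.$$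
   Context: Calabi potential: for $\sigma\in\mathcal{C}^2(\Omega)$, with $\Omega$ star-shaped with respect to the origin, $\mathbf{C}_{\delta,\sigma}\in\mathcal{C}^2(\Omega)$ is defined by $$\mathbf{C}_{\delta,\sigma}(x,y)=2\int_0^1 t\,\frac{\sigma(tx,ty)}{\delta(tx,ty)^2}\,dt .$$ Spaces: $\mathbb{E}^3(M,\sigma)$ (with $\epsilon=1$, Riemannian) and $\mathbb{L}^3(M,\sigma)$ (with $\epsilon=-1$, Lorentzian) denote $\Omega\times\mathbb{R}$, with coordinates $(x,y,z)$, endowed with the metric $$\frac{1}{\delta(x,y)^2}(dx^2+dy^2)+\epsilon\left(dz+\epsilon\,\mathbf{C}_{\delta,\sigma}(x,y)(y\,dx-x\,dy)\right)^2 .$$ The projection $(x,y,z)\mapsto(x,y)$ onto $M$ is a Killing submersion with unit Killing field $\partial_z$, and $\sigma$ is called its bundle curvature. Graphs: the graph of $u\in\mathcal{C}^2(\Omega')$, $\Omega'\subseteq\Omega$ open, is the surface $\{(x,y,u(x,y)):(x,y)\in\Omega'\}$. In the Lorentzian case it is called spacelike if the induced metric is Riemannian; in $\mathbb{L}^3(M,\sigma)$ this is equivalent to $1-\delta^2(\widetilde a^2+\widetilde b^2)>0$ with $\widetilde a=u_x-y\,\mathbf{C}_{\delta,\sigma}$, $\widetilde b=u_y+x\,\mathbf{C}_{\delta,\sigma}$. Mean curvature convention (half the trace of the second fundamental form, with the upward-pointing unit normal), viewed as a function on $\Omega'$: - The graph of $u$ in $\mathbb{E}^3(M,\sigma)$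 has mean curvature $h$ given by $2h=\delta^2\left(\partial_x\left(\frac{a}{w}\right)+\partial_y\left(\frac{b}{w}\right)\right)$, where $a=u_x+y\,\mathbf{C}_{\delta,\sigma}$, $b=u_y-x\,\mathbf{C}_{\delta,\sigma}$, $w=\sqrt{1+\delta^2(a^2+b^2)}$. - A spacelike graph of $u$ in $\mathbb{L}^3(M,\sigma)$ has mean curvature $\widetilde h$ given by $2\widetilde h=\delta^2\left(\partial_x\left(\frac{\widetilde a}{\widetilde w}\right)+\partial_y\left(\frac{\widetilde b}{\widetilde w}\right)\right)$, where $\widetilde a,\widetilde b$ are as in the previous paragraph and $\widetilde w=\sqrt{1-\delta^2(\widetilde a^2+\widetilde b^2)}$. *)

(* Defs.v *)
From Stdlib Require Import Reals.
From Coquelicot Require Import Coquelicot.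
Open Scope R_scope.

(** * Regularity and topology in the plane *)

Definition Dx (u : R -> R -> R) (x y : R) : R := Derive (fun s => u s y) x.
Definition Dy (u : R -> R -> R) (x y : R) : R := Derive (fun s => u x s) y.

(** Functions on an open set [D] are represented by total functions, of which
    only the values on [D] matter: on an open set, [ex_diff_n u k x y] depends
    only on the values of [u] near [(x, y)]. *)
Definition Ck (k : nat) (D : R * R -> Prop) (u : R -> R -> R) : Prop :=
  forall x y, D (x, y) -> ex_diff_n u k x y.

Definition smooth (D : R * R -> Prop) (u : R -> R -> R) : Prop :=
  forall k, Ck k D u.

Definition star_shaped (D : R * R -> Prop) : Prop :=
  D (0, 0) /\
  forall x y t, D (x, y) -> 0 <= t <= 1 -> D (t * x, t * y).

Definition unit_interval (t : R) : Prop := 0 <= t <= 1.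

Definition unit_square (p : R * R) : Prop :=
  unit_interval (fst p) /\ unit_interval (snd p).

Definition path_in (D : R * R -> Prop) (c : R -> R * R) : Prop :=
  continuous_on unit_interval c /\ forall t, unit_interval t -> D (c t).

Definition path_connected (D : R * R -> Prop) : Prop :=
  forall p q, D p -> D q -> exists c, path_in D c /\ c 0 = p /\ c 1 = q.

(** The second argument of [h] is the homotopy parameter; the base point is
    kept fixed. *)
Definition null_homotopic (D : R * R -> Prop) (c : R -> R * R) : Prop :=
  exists h : R * R -> R * R,
    continuous_on unit_square h /\
    (forall p, unit_square p -> D (h p)) /\
    (forall t, unit_interval t -> h (t, 0) = c t /\ h (t, 1) = c 0) /\
    (forall s, unit_interval s -> h (0, s) = c 0 /\ h (1, s) = c 0).

Definition simply_connected (D : R * R -> Prop) : Prop :=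
  (exists p, D p) /\ path_connected D /\
  forall c, path_in D c -> c 0 = c 1 -> null_homotopic D c.

(** * The ambient spaces *)

Definition calabi (delta sigma : R -> R -> R) (x y : R) : R :=
  2 * RInt (fun t => t * (sigma (t * x) (t * y) / delta (t * x) (t * y) ^ 2)) 0 1.

Definition space : Type := (R * R * R)%type.

(** A metric assigns a bilinear form on [R^3] to each point, tangent vectors
    being written in the coordinate frame. *)
Definition metric : Type := space -> space -> space -> R.

(** [delta^-2 (dx^2 + dy^2) + eps (dz + eps C (y dx - x dy))^2], with
    [eps = 1] or [eps = -1]. The points that matter are those lying over the
    domain of [delta]. *)
Definition killing_metric (eps : R) (delta sigma : R -> R -> R) : metric :=
  fun q v w =>
    let '(x, y, _) := q in
    let '(v1, v2, v3) := v in
    let '(w1, w2, w3) := w in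
    let C := calabi delta sigma x y in
    1 / delta x y ^ 2 * (v1 * w1 + v2 * w2)
    + eps * ((v3 + eps * C * (y * v1 - x * v2)) * (w3 + eps * C * (y * w1 - x * w2))).

Definition E3 := killing_metric 1.
Definition L3 := killing_metric (-1).

(** Directional derivative at [q] along [v]. *)
Definition dir_derive (phi : space -> R) (q v : space) : R :=
  Derive (fun t => phi (plus q (scal t v))) 0.

(** Koszul formula for vector fields with constant coordinates [v], [w], [n]
    (whose brackets vanish): this is the inner product with [n] of the
    Levi-Civita derivative of [w] along [v], that is, the contraction of the
    Christoffel symbols of the first kind with [v], [w] and [n]. *)
Definition christoffel (m : metric) (q v w n : space) : R :=
  (dir_derive (fun q' => m q' w n) q v
   + dir_derive (fun q' => m q' v n) q w
   - dir_derive (fun q' => m q' v w) q n) / 2.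

(** * Graphs *)

Definition graph (u : R -> R -> R) (x y : R) : space := (x, y, u x y).

(** Differential and second derivative of [graph u], applied to tangent vectors
    of the plane. *)
Definition graph_d (u : R -> R -> R) (x y : R) (V : R * R) : space :=
  (fst V, snd V, Dx u x y * fst V + Dy u x y * snd V).

Definition graph_d2 (u : R -> R -> R) (x y : R) (V W : R * R) : space :=
  (0, 0,
   Dx (Dx u) x y * (fst V * fst W)
   + Dy (Dx u) x y * (fst V * snd W + snd V * fst W)
   + Dy (Dy u) x y * (snd V * snd W)).

(** Induced metric, read in the parametrization [graph u]. *)
Definition first_form (m : metric) (u : R -> R -> R) (x y : R) (V W : R * R) : R :=
  m (graph u x y) (graph_d u x y V) (graph_d u x y W).

Definition spacelike (m : metric) (D : R * R -> Prop) (u : R -> R -> R) : Prop :=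
  forall x y, D (x, y) ->
  forall V, V <> (0, 0) -> 0 < first_form m u x y V V.

(** The sign [eps] is that of [m N N], and also that of [m] on the unit Killing
    field [(0, 0, 1)]: "upward" means that the component of [N] along the
    Killing field is positive. *)
Definition upward_unit_normal (eps : R) (m : metric) (u : R -> R -> R) (x y : R)
    (N : space) : Prop :=
  (forall V, m (graph u x y) (graph_d u x y V) N = 0) /\
  m (graph u x y) N N = eps /\
  0 < eps * m (graph u x y) N (0, 0, 1).

(** The coefficient along the unit normal [N] of the ambient covariant
    derivative of the graph; the factor [eps = m N N] accounts for timelike
    normals. With this sign, the mean curvature of the graph of [u] is half of
    [delta^2 ((a / w)_x + (b / w)_y)], where [a = u_x + eps y C],
    [b = u_y - eps x C] and [w = sqrt (1 + eps delta^2 (a^2 + b^2))]. *)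
Definition second_form (eps : R) (m : metric) (u : R -> R -> R) (x y : R)
    (N : space) (V W : R * R) : R :=
  eps * (m (graph u x y) (graph_d2 u x y V W) N
         + christoffel m (graph u x y) (graph_d u x y V) (graph_d u x y W) N).

(** Trace of the bilinear form [B] with respect to the metric [A]. *)
Definition trace_wrt (A B : R * R -> R * R -> R) : R :=
  let e1 := (1, 0) in
  let e2 := (0, 1) in
  (A e2 e2 * B e1 e1 - A e1 e2 * (B e1 e2 + B e2 e1) + A e1 e1 * B e2 e2)
  / (A e1 e1 * A e2 e2 - A e1 e2 ^ 2).

Definition has_mean_curvature (eps : R) (m : metric) (D : R * R -> Prop)
    (u h : R -> R -> R) : Prop :=
  forall x y, D (x, y) ->
  exists N, upward_unit_normal eps m u x y N /\
    trace_wrt (first_form m u x y) (second_form eps m u x y N) / 2 = h x y.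

Definition on_graph (D : R * R -> Prop) (u : R -> R -> R) (q : space) : Prop :=
  exists x y, D (x, y) /\ q = graph u x y.

(** Coordinate expression of a map defined on the graph of [u] with values in
    another graph, graphs being charted by the projection to the plane. *)
Definition chart_map (Phi : space -> space) (u : R -> R -> R) (x y : R) : R * R :=
  fst (Phi (graph u x y)).

Definition C2_map (D : R * R -> Prop) (phi : R -> R -> R * R) : Prop :=
  Ck 2 D (fun x y => fst (phi x y)) /\ Ck 2 D (fun x y => snd (phi x y)).

Definition map_d (phi : R -> R -> R * R) (x y : R) (V : R * R) : R * R :=
  (Dx (fun s t => fst (phi s t)) x y * fst V + Dy (fun s t => fst (phi s t)) x y * snd V,
   Dx (fun s t => snd (phi s t)) x y * fst V + Dy (fun s t => snd (phi s t)) x y * snd V).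

(** [Phi] is a conformal diffeomorphism from the graph of [u], with the metric
    induced by [m], onto the graph of [v], with the metric induced by [m']. *)
Definition conformal_diffeomorphism (D : R * R -> Prop)
    (m : metric) (u : R -> R -> R) (m' : metric) (v : R -> R -> R)
    (Phi : space -> space) : Prop :=
  (forall q, on_graph D u q -> on_graph D v (Phi q)) /\
  (exists Psi : space -> space,
     (forall q, on_graph D v q -> on_graph D u (Psi q)) /\
     (forall q, on_graph D u q -> Psi (Phi q) = q) /\
     (forall q, on_graph D v q -> Phi (Psi q) = q) /\
     C2_map D (chart_map Phi u) /\ C2_map D (chart_map Psi v)) /\
  exists lambda : space -> R,
    (forall q, on_graph D u q -> 0 < lambda q) /\
    forall x y, D (x, y) -> forall V W,
      let phi := chart_map Phi u in
      first_form m' v (fst (phi x y)) (snd (phi x y)) (map_d phi x y V) (map_d phi x y W)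
      = lambda (graph u x y) * first_form m u x y V W.

(** * Twin relations *)

Definition alpha (delta tau f : R -> R -> R) (x y : R) : R :=
  Dx f x y + y * calabi delta tau x y.
Definition beta (delta tau f : R -> R -> R) (x y : R) : R :=
  Dy f x y - x * calabi delta tau x y.
Definition omega (delta tau f : R -> R -> R) (x y : R) : R :=
  sqrt (1 + delta x y ^ 2 * (alpha delta tau f x y ^ 2 + beta delta tau f x y ^ 2)).

Definition alpha' (delta H g : R -> R -> R) (x y : R) : R :=
  Dx g x y - y * calabi delta H x y.
Definition beta' (delta H g : R -> R -> R) (x y : R) : R :=
  Dy g x y + x * calabi delta H x y.
Definition omega' (delta H g : R -> R -> R) (x y : R) : R :=
  sqrt (1 - delta x y ^ 2 * (alpha' delta H g x y ^ 2 + beta' delta H g x y ^ 2)).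

Definition twin (delta tau H f g : R -> R -> R) (D : R * R -> Prop) : Prop :=
  forall x y, D (x, y) ->
  (alpha' delta H g x y, beta' delta H g x y)
  = (- (beta delta tau f x y / omega delta tau f x y),
     alpha delta tau f x y / omega delta tau f x y).

Definition twin_inv (delta tau H f g : R -> R -> R) (D : R * R -> Prop) : Prop :=
  forall x y, D (x, y) ->
  (alpha delta tau f x y, beta delta tau f x y)
  = (beta' delta H g x y / omega' delta H g x y,
     - (alpha' delta H g x y / omega' delta H g x y)).

(* Main.v *)
(** Write [a, b] for the horizontal slopes of a graph and [w] for its area factor, so that its
    mean curvature equation reads [delta^2 ((a / w)_x + (b / w)_y) = 2 H]. Differentiating the
    integral along rays that defines it, the Calabi potential [C] of [sigma] satisfies
    [(x C)_x + (y C)_y = 2 sigma / delta^2], so the mean curvature equation says exactly that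
    the 1-form whose coefficients, corrected by the Calabi terms of [H], are [(- b / w, a / w)]
    is closed. It therefore has a potential [g] on the simply connected domain; the area factor
    of [g] is [1 / w], hence the mean curvature of [g] is the curl of the slopes [(a, b)] of [f],
    which is [tau]. A sign [eps] treats both directions at once.

    As simple connectedness is given by continuous homotopies, a closed form is integrated along
    a path by summing the local potential differences of a fine subdivision; on a fine grid these
    sums do not change from one row of a homotopy to the next. *)
From Stdlib Require Import Reals Lra Lia Classical ClassicalEpsilon.
From Coquelicot Require Import Coquelicot.
Require Import Defs.
Open Scope R_scope.

(** * Potentials on simply connected domains *)

(** Paths and homotopies are merely continuous, so a line integral along them has no direct meaning.
    What survives is a function [U] of pairs of points that is additive on small balls and arbitrary
    on distant pairs. For a closed form it is the integral along a horizontal and then a vertical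
    leg: balls of the product metric are squares, so these legs stay in any ball that contains both
    ends. Local additivity makes the sums over all fine subdivisions equal, so no limit is taken.

    The mean curvature is the trace of a second fundamental form given by the Koszul formula, with
    an existentially quantified normal; its divergence form therefore rests on the uniqueness of the
    upward unit normal. Passing to the twin turns the slope field by a right angle and changes the
    squared area factor from [W] to [1 / W]. The twin of a graph in [E3] is thereby spacelike, while
    for a start in [L3] spacelikeness is what makes the square root positive. As the Calabi
    potentials are of class C^1, a C^2 graph gives a C^1 form, whose potential is again C^2. *)

Definition locally_additive (D : R * R -> Prop) (U : R * R -> R * R -> R) : Prop :=
  forall p, D p -> exists r : posreal, forall a b c,
    ball p r a -> ball p r b -> ball p r c -> U a c = U a b + U b c.

Fixpoint chain_sum (U : R * R -> R * R -> R) (c : nat -> R * R) (n : nat) : R :=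
  match n with
  | O => 0
  | S m => chain_sum U c m + U (c m) (c (S m))
  end.

Definition path_sum U (c : R -> R * R) (n : nat) : R :=
  chain_sum U (fun i => c (INR i / INR n)) n.

Lemma chain_sum_ext U (c c' : nat -> R * R) n :
  (forall i, (i <= n)%nat -> c i = c' i) -> chain_sum U c n = chain_sum U c' n.
Proof.
  induction n as [|n IH]; intros E; [reflexivity|].
  simpl; rewrite IH, !E; auto.
Qed.

Lemma chain_sum_add U (c : nat -> R * R) n m :
  chain_sum U c (n + m) = chain_sum U c n + chain_sum U (fun i => c (n + i)%nat) m.
Proof.
  induction m as [|m IH].
  - rewrite Nat.add_0_r; simpl; ring.
  - rewrite Nat.add_succ_r; simpl; rewrite IH, Nat.add_succ_r; ring.
Qed.

(** A discrete Stokes formula: the hypothesis says that the two ways around each cell between the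
    chains agree, and the inner rungs cancel in the sum over the cells. *)
Lemma chain_sum_ladder U (a b : nat -> R * R) n :
  (forall i, (i < n)%nat ->
     U (a i) (a (S i)) + U (a (S i)) (b (S i)) = U (a i) (b i) + U (b i) (b (S i))) ->
  chain_sum U a n + U (a n) (b n) = U (a O) (b O) + chain_sum U b n.
Proof.
  induction n as [|n IH]; intros E; simpl; [ring|].
  assert (H1 := IH ltac:(intros; apply E; lia)).
  assert (H2 := E n ltac:(lia)).
  lra.
Qed.

Lemma INR_div_unit i n : (i <= n)%nat -> (0 < n)%nat -> unit_interval (INR i / INR n).
Proof.
  intros Hi Hn; apply lt_0_INR in Hn; apply le_INR in Hi.
  assert (Hp := pos_INR i); split.
  - apply Rmult_le_pos; [lra|]. left; apply Rinv_0_lt_compat; lra.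
  - apply Rmult_le_reg_r with (INR n); [lra|]. unfold Rdiv; rewrite Rmult_assoc, Rinv_l; lra.
Qed.

Lemma INR_div_succ i n : (0 < n)%nat -> INR (S i) / INR n = INR i / INR n + / INR n.
Proof. intros Hn; apply lt_0_INR in Hn; rewrite S_INR; field; lra. Qed.

Lemma INR_div_diag n : (0 < n)%nat -> INR n / INR n = 1.
Proof. intros Hn; apply lt_0_INR in Hn; field; lra. Qed.

Lemma INR_div_0 n : INR 0 / INR n = 0.
Proof. simpl; unfold Rdiv; ring. Qed.

Lemma exists_mesh (d : posreal) :
  exists N, forall n, (N <= n)%nat -> (0 < n)%nat /\ 0 < / INR n < d.
Proof.
  destruct (archimed_cor1 d (cond_pos d)) as (N & H1 & H2).
  exists N; intros n Hn; assert (Hn0 : (0 < n)%nat) by lia; split; auto.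
  assert (Hn' := lt_0_INR _ Hn0); assert (HN := lt_0_INR _ H2).
  split; [apply Rinv_0_lt_compat; auto|].
  apply Rle_lt_trans with (2 := H1), Rinv_le_contravar; auto; now apply le_INR.
Qed.

Lemma ball_plane (p q : R * R) (r : R) :
  ball p r q <-> Rabs (fst q - fst p) < r /\ Rabs (snd q - snd p) < r.
Proof. reflexivity. Qed.

(** Additivity near each [h s] pulls back through [h] to a neighbourhood of [s] in the square, and
    compactness makes the size of these neighbourhoods uniform. *)
Lemma lebesgue_number D U (h : R * R -> R * R) :
  locally_additive D U -> continuous_on unit_square h ->
  (forall s, unit_square s -> D (h s)) ->
  exists d : posreal, forall s a b c,
    unit_square s -> unit_square a -> unit_square b -> unit_square c ->
    ball s d a -> ball s d b -> ball s d c ->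
    U (h a) (h c) = U (h a) (h b) + U (h b) (h c).
Proof.
  intros HU Hc HD.
  (* Doubling the radius leaves room: a point within [d <= e] of a point that is itself within [e]
     of the centre is still within [2 * e] of the centre. *)
  pose (good (s : R * R) (e : R) := forall a b c,
    unit_square a -> unit_square b -> unit_square c ->
    ball s (2 * e) a -> ball s (2 * e) b -> ball s (2 * e) c ->
    U (h a) (h c) = U (h a) (h b) + U (h b) (h c)).
  assert (Hloc : forall s, exists e : posreal, unit_square s -> good s e).
  { intros s; destruct (classic (unit_square s)) as [Hs|Hs];
      [|now exists (mkposreal 1 Rlt_0_1)].
    destruct (HU _ (HD s Hs)) as (r & Hr).
    destruct (Hc s Hs (ball (h s) r) (locally_ball _ _)) as (e & He).
    exists (mkposreal _ (is_pos_div_2 e)); intros _ a b c Ha Hb Hc' Ba Bb Bc.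
    simpl in Ba, Bb, Bc; replace (2 * (e / 2)) with (pos e) in * by field.
    apply Hr; apply He; auto. }
  pose (delta u v := proj1_sig (constructive_indefinite_description _ (Hloc (u, v)))).
  destruct (compactness_value_2d 0 1 0 1 delta) as (d & Hd).
  exists d; intros [x y] a b c [Hx Hy] Ha Hb Hc' Ba Bb Bc.
  specialize (Hd x y Hx Hy); apply NNPP in Hd.
  destruct Hd as (u & v & Hu & Hv & Hxu & Hyv & Hdd).
  unfold delta in *; destruct constructive_indefinite_description as [e He]; simpl in *.
  assert (Ht : forall q, ball (x, y) d q -> ball (u, v) (2 * e) q).
  { intros [q1 q2] Bq; destruct (proj1 (ball_plane _ _ _) Bq) as [B1 B2].
    simpl fst in B1; simpl snd in B2.
    apply ball_plane; simpl fst; simpl snd; split.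
    - replace (q1 - u) with ((q1 - x) + (x - u)) by ring.
      apply Rle_lt_trans with (1 := Rabs_triang _ _); lra.
    - replace (q2 - v) with ((q2 - y) + (y - v)) by ring.
      apply Rle_lt_trans with (1 := Rabs_triang _ _); lra. }
  apply (He (conj Hu Hv)); auto.
Qed.

Lemma locally_additive_diag D U p : locally_additive D U -> D p -> U p p = 0.
Proof.
  intros HU Hp; destruct (HU p Hp) as (r & Hr).
  specialize (Hr p p p (ball_center _ _) (ball_center _ _) (ball_center _ _)); lra.
Qed.

Lemma chain_sum_const U p n : U p p = 0 -> chain_sum U (fun _ => p) n = 0.
Proof. intros E; induction n as [|n IH]; simpl; lra. Qed.

(** On an [n] by [n] grid finer than the Lebesgue number, neighbouring rows of the homotopy form a
    ladder. Its end rungs contribute [U (c 0) (c 0) = 0], because the base point is fixed, so all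
    rows have the sum of the last one, which is constant. *)
Lemma null_homotopic_path_sum D U c :
  locally_additive D U -> path_in D c -> null_homotopic D c ->
  exists N, forall n, (N <= n)%nat -> path_sum U c n = 0.
Proof.
  intros HU Hpath (h & Hc & HD & Hb & Hs).
  destruct (lebesgue_number D U h HU Hc HD) as (d & Hd).
  destruct (exists_mesh d) as (N & HN).
  exists N; intros n Hn; destruct (HN n Hn) as (Hn0 & Hn1).
  assert (HI : forall i, (i <= n)%nat -> unit_interval (INR i / INR n))
    by (intros; now apply INR_div_unit).
  assert (H0 : unit_interval 0) by (unfold unit_interval; lra).
  assert (Hd0 : U (c 0) (c 0) = 0)
    by (apply (locally_additive_diag D); auto; now apply Hpath).
  pose (row j i := h (INR i / INR n, INR j / INR n)).
  assert (Hrow : forall j, (j < n)%nat -> chain_sum U (row j) n = chain_sum U (row (S j)) n).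
  { intros j Hj.
    assert (L : chain_sum U (row j) n + U (row j n) (row (S j) n)
                = U (row j O) (row (S j) O) + chain_sum U (row (S j)) n).
    { apply chain_sum_ladder; intros i Hi; unfold row.
      assert (Hsq : forall k l, (k <= n)%nat -> (l <= n)%nat ->
                unit_square (INR k / INR n, INR l / INR n)) by (split; simpl; auto).
      assert (HB : forall k l, (k = i \/ k = S i) -> (l = j \/ l = S j) ->
                ball (INR i / INR n, INR j / INR n) d (INR k / INR n, INR l / INR n)).
      { intros k l Hk Hl; apply ball_plane; simpl fst; simpl snd; split.
        - destruct Hk; subst k; rewrite ?INR_div_succ by auto;
            apply Rabs_def1; lra.
        - destruct Hl; subst l; rewrite ?INR_div_succ by auto;
            apply Rabs_def1; lra. }
      pose (s := (INR i / INR n, INR j / INR n)).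
      (* Both routes around a cell equal the value of [U] on its diagonal; all corners of the cell
         lie in the ball of radius [d] about its lower left corner [s]. *)
      rewrite <- (Hd s), <- (Hd s); auto; unfold s; try apply Hsq; try apply HB; auto; lia. }
    unfold row in L; rewrite INR_div_diag, INR_div_0 in L by auto.
    assert (Hj' := HI _ (Nat.lt_le_incl _ _ Hj)).
    rewrite !(proj1 (Hs _ Hj')), !(proj2 (Hs _ Hj')) in L.
    rewrite !(proj1 (Hs _ (HI _ Hj))), !(proj2 (Hs _ (HI _ Hj))) in L.
    unfold row; lra. }
  assert (Hall : forall j, (j <= n)%nat -> chain_sum U (row O) n = chain_sum U (row j) n).
  { induction j as [|j IH]; intros Hj; [reflexivity|].
    rewrite IH by lia; apply Hrow; lia. }
  transitivity (chain_sum U (row O) n).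
  - apply chain_sum_ext; intros i Hi; unfold row; rewrite INR_div_0.
    symmetry; apply Hb; auto.
  - rewrite (Hall n) by auto.
    transitivity (chain_sum U (fun _ => c 0) n); [|now apply chain_sum_const].
    apply chain_sum_ext; intros i Hi; unfold row; rewrite INR_div_diag by auto.
    apply Hb; auto.
Qed.

(** The integral along a path as an eventually constant value: by local additivity the sums over
    fine subdivisions are equal, not merely close. *)
Definition path_value U (c : R -> R * R) (v : R) : Prop :=
  exists N, forall n, (N <= n)%nat -> path_sum U c n = v.

Lemma path_value_unique U c v w : path_value U c v -> path_value U c w -> v = w.
Proof.
  intros (N & HN) (M & HM).
  rewrite <- (HN (N + M)%nat), <- (HM (N + M)%nat); auto; lia.
Qed.

(** Instead of comparing two subdivisions through a common refinement, the proof builds a primitive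
    [phi] of [U] along the path. Every fine subdivision then telescopes to [phi 1 - phi 0], whatever
    its number of points. *)
Lemma path_value_exists D U c :
  locally_additive D U -> path_in D c -> exists v, path_value U c v.
Proof.
  intros HU [Hc HD].
  (* A path is regarded as a map of the square that ignores the second coordinate. *)
  destruct (lebesgue_number D U (fun s => c (fst s)) HU) as (d & Hd).
  { intros s Hs P HP; destruct (Hc (fst s) (proj1 Hs) P HP) as (e & He).
    exists e; intros q Bq Hq; apply He; [apply Bq | apply Hq]. }
  { intros s Hs; apply HD, Hs. }
  assert (Hadd : forall s a b e, unit_interval s -> unit_interval a -> unit_interval b ->
    unit_interval e -> Rabs (a - s) < d -> Rabs (b - s) < d -> Rabs (e - s) < d ->
    U (c a) (c e) = U (c a) (c b) + U (c b) (c e)).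
  { intros s a b e Is Ia Ib Ie Ha Hb He.
    assert (I0 : unit_interval 0) by (unfold unit_interval; lra).
    assert (Hz : Rabs (0 - 0) < d) by (rewrite Rminus_0_r, Rabs_R0; apply cond_pos).
    apply (Hd (s, 0) (a, 0) (b, 0) (e, 0)); try (split; assumption);
      apply ball_plane; simpl fst; simpl snd; auto. }
  clear Hd.
  (* Half of [d], since opposite corners of a cell below differ both by one step of the mesh and by
     the change from [t] to [t']. *)
  destruct (exists_mesh (mkposreal _ (is_pos_div_2 d))) as (N & HN); simpl in HN.
  destruct (HN N ltac:(lia)) as (HN0 & HN1).
  (* [phi t] is the sum with the fixed number [N] of pieces along the path stopped at time [t]. The
     ladder between the paths stopped at [t] and [t'] identifies the increment of [phi] with its
     last rung. *)
  pose (phi t := chain_sum U (fun i => c (INR i / INR N * t)) N).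
  assert (Hphi : forall t t', unit_interval t -> unit_interval t' -> Rabs (t' - t) < d / 2 ->
     U (c t) (c t') = phi t' - phi t).
  { intros t t' Ht Ht' Htt.
    assert (L : phi t + U (c (INR N / INR N * t)) (c (INR N / INR N * t'))
                = U (c (INR 0 / INR N * t)) (c (INR 0 / INR N * t')) + phi t').
    { apply (chain_sum_ladder U (fun i => c (INR i / INR N * t)) (fun i => c (INR i / INR N * t'))).
      intros i Hi.
      assert (Hu : forall k r, (k <= N)%nat -> unit_interval r ->
                unit_interval (INR k / INR N * r)).
      { intros k r Hk [Hr1 Hr2]; destruct (INR_div_unit k N Hk HN0) as [Hk1 Hk2]; split.
        - now apply Rmult_le_pos.
        - rewrite <- (Rmult_1_l 1); apply Rmult_le_compat; auto. }
      assert (HB : forall k r, (k = i \/ k = S i) -> (r = t \/ r = t') ->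
                Rabs (INR k / INR N * r - INR i / INR N * t) < d).
      { intros k r Hk Hr.
        replace (INR k / INR N * r - INR i / INR N * t)
          with ((INR k / INR N - INR i / INR N) * r + INR i / INR N * (r - t)) by ring.
        apply Rle_lt_trans with (1 := Rabs_triang _ _); rewrite !Rabs_mult.
        assert (A1 : Rabs (INR k / INR N - INR i / INR N) <= / INR N).
        { destruct Hk; subst k; rewrite ?INR_div_succ by auto; apply Rabs_le; lra. }
        assert (A2 : Rabs r <= 1)
          by (unfold unit_interval in *; apply Rabs_le; destruct Hr; subst r; lra).
        assert (A3 : Rabs (INR i / INR N) <= 1)
          by (destruct (INR_div_unit i N) as [? ?]; [lia|auto|]; apply Rabs_le; lra).
        assert (A4 : Rabs (r - t) < d / 2).
        { destruct Hr; subst r; auto. rewrite Rminus_diag, Rabs_R0.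
          destruct d; simpl; lra. }
        assert (B1 : Rabs (INR k / INR N - INR i / INR N) * Rabs r <= / INR N * 1)
          by (apply Rmult_le_compat; auto using Rabs_pos).
        assert (B2 : Rabs (INR i / INR N) * Rabs (r - t) <= 1 * Rabs (r - t))
          by (apply Rmult_le_compat_r; auto using Rabs_pos).
        lra. }
      rewrite <- (Hadd (INR i / INR N * t)), <- (Hadd (INR i / INR N * t));
        auto; try apply Hu; auto; try apply HB; auto; lia. }
    rewrite INR_div_diag, INR_div_0, !Rmult_1_l, !Rmult_0_l in L by auto.
    rewrite (locally_additive_diag D U (c 0)) in L; auto; [lra|].
    apply HD; unfold unit_interval; lra. }
  exists (phi 1 - phi 0), N; intros n Hn; destruct (HN n Hn) as (Hn0 & Hn1).
  assert (Htel : forall k, (k <= n)%nat ->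
     chain_sum U (fun i => c (INR i / INR n)) k = phi (INR k / INR n) - phi 0).
  { induction k as [|k IH]; intros Hk.
    - rewrite INR_div_0; simpl; ring.
    - cbn [chain_sum]; rewrite IH by lia.
      rewrite Hphi; try apply INR_div_unit; try lia; [ring|].
      rewrite INR_div_succ by auto; apply Rabs_def1; lra. }
  unfold path_sum; rewrite Htel by auto; now rewrite INR_div_diag.
Qed.

(** * Concatenation of paths *)

Definition clamp (t : R) : R := Rmax 0 (Rmin 1 t).

Lemma clamp_unit t : unit_interval (clamp t).
Proof. unfold clamp, unit_interval, Rmax, Rmin; repeat destruct Rle_dec; lra. Qed.

Lemma clamp_id t : unit_interval t -> clamp t = t.
Proof. unfold clamp, unit_interval, Rmax, Rmin; repeat destruct Rle_dec; lra. Qed.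

Lemma clamp_le_0 t : t <= 0 -> clamp t = 0.
Proof. unfold clamp, Rmax, Rmin; repeat destruct Rle_dec; lra. Qed.

Lemma clamp_ge_1 t : 1 <= t -> clamp t = 1.
Proof. unfold clamp, Rmax, Rmin; repeat destruct Rle_dec; lra. Qed.

Lemma clamp_lipschitz s t : Rabs (clamp t - clamp s) <= Rabs (t - s).
Proof.
  unfold clamp, Rmax, Rmin, Rabs;
    repeat destruct Rle_dec; repeat destruct Rcase_abs; lra.
Qed.

(** Extending a path by constants turns continuity relative to the unit interval into continuity on
    the whole line, where the algebraic rules for continuous functions apply. The affine change of
    parameter is the one needed by [join]. *)
Lemma continuous_clamp (c : R -> R * R) (k m t : R) :
  continuous_on unit_interval c -> continuous (fun s => c (clamp (k * s + m))) t.
Proof.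
  intros Hc.
  assert (Haff : continuous (fun s : R => k * s + m) t).
  { apply (ex_derive_continuous (fun s => k * s + m)); auto_derive; auto. }
  intros P HP.
  destruct (Hc _ (clamp_unit (k * t + m)) P HP) as (e & He).
  destruct (Haff (ball (k * t + m) e) (locally_ball _ _)) as (e' & He').
  exists e'; intros s Bs; apply He; [|apply clamp_unit].
  apply Rle_lt_trans with (2 := He' s Bs), clamp_lipschitz.
Qed.

Lemma continuous_path_on (D : R -> Prop) (c : R -> R * R) :
  (forall t, continuous c t) -> continuous_on D c.
Proof. intros Hc t _ P HP; exact (filter_le_within D _ (Hc t P HP)). Qed.

(** A sum instead of a case distinction, so that continuity is immediate: up to time 1/2 the second
    summand vanishes, and afterwards the first one stays at [c1 1], which cancels [c2 0]. *)
Definition join (c1 c2 : R -> R * R) (t : R) : R * R :=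
  plus (c1 (clamp (2 * t + 0))) (minus (c2 (clamp (2 * t + -1))) (c2 0)).

Lemma join_left c1 c2 t : t <= 1 / 2 -> join c1 c2 t = c1 (clamp (2 * t + 0)).
Proof.
  intros Ht; unfold join; rewrite (clamp_le_0 (2 * t + -1)) by lra.
  rewrite minus_eq_zero; apply plus_zero_r.
Qed.

Lemma join_right c1 c2 t :
  c1 1 = c2 0 -> 1 / 2 <= t -> join c1 c2 t = c2 (clamp (2 * t + -1)).
Proof.
  intros E Ht; unfold join; rewrite (clamp_ge_1 (2 * t + 0)) by lra.
  rewrite E; apply injective_projections; simpl; unfold plus, minus, opp, plus; simpl; ring.
Qed.

Lemma path_in_join D c1 c2 :
  path_in D c1 -> path_in D c2 -> c1 1 = c2 0 -> path_in D (join c1 c2).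
Proof.
  intros [C1 D1] [C2 D2] E; split.
  - apply continuous_path_on; intros t.
    apply (continuous_plus (fun s => c1 (clamp (2 * s + 0)))
             (fun s => minus (c2 (clamp (2 * s + -1))) (c2 0))).
    + now apply continuous_clamp.
    + apply (continuous_minus (fun s => c2 (clamp (2 * s + -1))) (fun _ => c2 0)).
      * now apply continuous_clamp.
      * apply continuous_const.
  - intros t _; destruct (Rle_dec t (1 / 2)) as [Ht|Ht].
    + rewrite join_left by auto; apply D1, clamp_unit.
    + rewrite join_right by (auto; lra); apply D2, clamp_unit.
Qed.

(** An even number of pieces puts a subdivision point at the junction time 1/2. *)
Lemma path_sum_join U c1 c2 n : (0 < n)%nat -> c1 1 = c2 0 ->
  path_sum U (join c1 c2) (n + n) = path_sum U c1 n + path_sum U c2 n.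
Proof.
  intros Hn E; unfold path_sum; rewrite chain_sum_add.
  assert (Hn' := lt_0_INR _ Hn).
  f_equal; apply chain_sum_ext; intros i Hi; destruct (INR_div_unit i n Hi Hn) as [H0 H1].
  - assert (Q : INR i / INR (n + n) = INR i / INR n / 2) by (rewrite plus_INR; field; lra).
    rewrite Q, join_left by lra.
    f_equal; rewrite clamp_id; [lra|]; split; lra.
  - assert (Q : INR (n + i) / INR (n + n) = INR i / INR n / 2 + / 2)
      by (rewrite !plus_INR; field; lra).
    rewrite Q, join_right by (auto; lra).
    f_equal; rewrite clamp_id; [lra|]; split; lra.
Qed.

(** The joined path has some value by [path_value_exists]; since its sums are eventually constant,
    the even subdivisions suffice to identify it. *)
Lemma path_value_join D U c1 c2 v1 v2 :
  locally_additive D U -> path_in D c1 -> path_in D c2 -> c1 1 = c2 0 ->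
  path_value U c1 v1 -> path_value U c2 v2 -> path_value U (join c1 c2) (v1 + v2).
Proof.
  intros HU P1 P2 E (N1 & H1) (N2 & H2).
  destruct (path_value_exists D U _ HU (path_in_join D c1 c2 P1 P2 E)) as (v & N & HN).
  exists N; intros n Hn; rewrite HN by auto.
  pose (m := (S (N + N1 + N2))%nat).
  rewrite <- (HN (m + m)%nat), path_sum_join, (H1 m), (H2 m); auto; unfold m; lia.
Qed.

Lemma join_0 c1 c2 : join c1 c2 0 = c1 0.
Proof. rewrite join_left, clamp_id; unfold unit_interval; try f_equal; lra. Qed.

Lemma join_1 c1 c2 : c1 1 = c2 0 -> join c1 c2 1 = c2 1.
Proof. intros E; rewrite join_right, clamp_id; unfold unit_interval; auto; try f_equal; lra. Qed.

Definition segment (p q : R * R) (t : R) : R * R := plus p (scal t (minus q p)).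

Lemma segment_in_ball p q (r : posreal) t :
  ball p r q -> unit_interval t -> ball p r (segment p q t).
Proof.
  intros B [T0 T1]; destruct (proj1 (ball_plane _ _ _) B) as [B1 B2]; apply ball_plane.
  assert (Ht : Rabs t <= 1) by (apply Rabs_le; lra).
  destruct p as [p1 p2], q as [q1 q2]; simpl in *.
  unfold scal, plus, minus, opp, plus, mult; simpl; unfold mult; simpl.
  split.
  - replace (p1 + t * (q1 + - p1) - p1) with (t * (q1 - p1)) by ring.
    rewrite Rabs_mult; apply Rle_lt_trans with (2 := B1).
    rewrite <- (Rmult_1_l (Rabs (q1 - p1))) at 2.
    apply Rmult_le_compat_r; auto using Rabs_pos.
  - replace (p2 + t * (q2 + - p2) - p2) with (t * (q2 - p2)) by ring.
    rewrite Rabs_mult; apply Rle_lt_trans with (2 := B2).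
    rewrite <- (Rmult_1_l (Rabs (q2 - p2))) at 2.
    apply Rmult_le_compat_r; auto using Rabs_pos.
Qed.

Lemma segment_0 p q : segment p q 0 = p.
Proof. unfold segment; change 0 with (@zero R_Ring); rewrite scal_zero_l; apply plus_zero_r. Qed.

Lemma segment_1 p q : segment p q 1 = q.
Proof.
  apply injective_projections; unfold segment; simpl; unfold scal, minus, plus, opp; simpl;
    unfold mult; simpl; ring.
Qed.

Lemma path_in_segment (D : R * R -> Prop) p q (r : posreal) :
  (forall z, ball p r z -> D z) -> ball p r q -> path_in D (segment p q).
Proof.
  intros HD B; split.
  - apply continuous_path_on; intros t.
    apply (continuous_plus (fun _ => p) (fun s : R => scal s (minus q p))).
    + apply continuous_const.
    + apply (continuous_scal_l (fun s : R => s) (minus q p)), continuous_id.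
  - intros t Ht; apply HD, segment_in_ball; auto.
Qed.

Lemma path_value_segment (U : R * R -> R * R -> R) p q (r : posreal) :
  (forall a b c, ball p r a -> ball p r b -> ball p r c -> U a c = U a b + U b c) ->
  ball p r q -> path_value U (segment p q) (U p q).
Proof.
  intros Hr B; exists 1%nat; intros n Hn.
  assert (Bp : ball p r p) by apply ball_center.
  assert (Bs : forall k, (k <= n)%nat -> ball p r (segment p q (INR k / INR n)))
    by (intros k Hk; apply segment_in_ball; auto; apply INR_div_unit; auto; lia).
  assert (Htel : forall k, (k <= n)%nat ->
     chain_sum U (fun i => segment p q (INR i / INR n)) k = U p (segment p q (INR k / INR n))).
  { induction k as [|k IH]; intros Hk.
    - rewrite INR_div_0, segment_0; simpl; specialize (Hr p p p Bp Bp Bp); lra.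
    - cbn [chain_sum]; rewrite IH by lia; symmetry; apply Hr; auto; apply Bs; lia. }
  unfold path_sum; rewrite Htel, INR_div_diag, segment_1; auto; lia.
Qed.

(* Comparing the loops [p0 -> p -> q -> p0] and [p0 -> q -> p0] shows that the
   value of a chosen path from [p0] is a potential. *)
Lemma simply_connected_potential D U :
  open D -> simply_connected D -> locally_additive D U ->
  exists g : R * R -> R, forall p, D p ->
    exists r : posreal, forall q, ball p r q -> D q /\ g q = g p + U p q.
Proof.
  intros Ho ([p0 Hp0] & Hpc & Hsc) HU.
  (* The value exists for every point of the plane, with a dummy 0 off [D], so that description
     yields a total function. *)
  assert (Hch : forall p, exists v, D p ->
    exists c, path_in D c /\ c 0 = p0 /\ c 1 = p /\ path_value U c v).
  { intros p; destruct (classic (D p)) as [Hp|Hp]; [|now exists 0].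
    destruct (Hpc p0 p Hp0 Hp) as (c & Pc & C0 & C1).
    destruct (path_value_exists D U c HU Pc) as (v & Hv).
    exists v; intros _; exists c; auto. }
  exists (fun p => proj1_sig (constructive_indefinite_description _ (Hch p))).
  intros p Hp; destruct (HU p Hp) as (r1 & Hr1), (Ho p Hp) as (r2 & Hr2).
  exists (mkposreal _ (Rmin_stable_in_posreal r1 r2)); simpl; intros q Bq.
  assert (Bq1 : ball p r1 q) by (apply ball_le with (2 := Bq), Rmin_l).
  assert (Bq2 : ball p r2 q) by (apply ball_le with (2 := Bq), Rmin_r).
  assert (Hq := Hr2 q Bq2); split; auto.
  destruct (constructive_indefinite_description _ (Hch q)) as (w & Hw).
  destruct (constructive_indefinite_description _ (Hch p)) as (v & Hv); simpl.
  destruct (Hw Hq) as (cq & Pq & Q0 & Q1 & Vq), (Hv Hp) as (cp & Pp & P0 & P1 & Vp).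
  destruct (Hpc q p0 Hq Hp0) as (e & Pe & E0 & E1).
  destruct (path_value_exists D U e HU Pe) as (x & Vx).
  assert (Hloop : forall c y, path_in D c -> c 0 = c 1 -> path_value U c y -> y = 0).
  { intros c y Pc Hcl Vc; apply (path_value_unique U c); auto.
    apply (null_homotopic_path_sum D); auto. }
  assert (Hs := path_in_segment D p q r2 Hr2 Bq2).
  assert (Vs := path_value_segment U p q r1 Hr1 Bq1).
  assert (A : w + x = 0).
  { apply (Hloop (join cq e)).
    - apply path_in_join; auto; congruence.
    - rewrite join_0, join_1; congruence.
    - apply (path_value_join D); auto; congruence. }
  assert (Es : cp 1 = segment p q 0) by (rewrite segment_0; auto).
  assert (Ee : join cp (segment p q) 1 = e 0) by (rewrite join_1, segment_1; congruence).
  assert (B : v + U p q + x = 0).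
  { apply (Hloop (join (join cp (segment p q)) e)).
    - apply path_in_join; auto; apply path_in_join; auto.
    - rewrite !join_0, join_1; congruence.
    - apply (path_value_join D); auto; [apply path_in_join; auto|].
      apply (path_value_join D); auto. }
  lra.
Qed.

(** * Calculus of [C^1] functions on a plane domain *)

(** The partial derivatives are carried as explicit functions rather than as [Dx u] and [Dy u]: the
    rules below then compute them, and closedness of a form becomes an algebraic identity. *)
Definition has_C1 (D : R * R -> Prop) (u ux uy : R -> R -> R) : Prop :=
  forall x y, D (x, y) ->
  is_derive (fun s => u s y) x (ux x y) /\ is_derive (fun s => u x s) y (uy x y) /\
  continuity_2d_pt ux x y /\ continuity_2d_pt uy x y.

Lemma open_locally_2d (D : R * R -> Prop) x y :
  open D -> D (x, y) -> locally_2d (fun u v => D (u, v)) x y.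
Proof.
  intros Ho Hp; apply locally_2d_locally.
  apply filter_imp with (2 := Ho _ Hp); now intros [u v].
Qed.

Lemma continuity_2d_pt_comp (f g h : R -> R -> R) x y :
  continuity_2d_pt f (g x y) (h x y) ->
  continuity_2d_pt g x y -> continuity_2d_pt h x y ->
  continuity_2d_pt (fun u v => f (g u v) (h u v)) x y.
Proof.
  intros Hf Hg Hh eps.
  destruct (Hf eps) as (d & Hd).
  apply locally_2d_impl with (2 := Hg d).
  apply locally_2d_impl with (2 := Hh d).
  apply locally_2d_forall; auto.
Qed.

Section C1.
Variable D : R * R -> Prop.
Hypothesis Ho : open D.

Lemma has_C1_differentiable u ux uy x y :
  has_C1 D u ux uy -> D (x, y) -> differentiable_pt_lim u x y (ux x y) (uy x y).
Proof.
  intros Hu Hp; apply filterdiff_differentiable_pt_lim.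
  apply filterdiff_ext_lin with
    (fun w : R * R => plus (scal (fst w) (ux x y)) (scal (snd w) (uy x y)));
    [|reflexivity].
  apply is_derive_filterdiff.
  - apply filter_imp with (2 := Ho _ Hp); intros [a b] Hab; apply (Hu a b Hab).
  - apply (Hu x y Hp).
  - apply continuity_2d_pt_filterlim, (Hu x y Hp).
Qed.

Lemma has_C1_continuity u ux uy x y :
  has_C1 D u ux uy -> D (x, y) -> continuity_2d_pt u x y.
Proof.
  intros Hu Hp; apply differentiable_continuity_pt.
  exists (ux x y), (uy x y); now apply has_C1_differentiable.
Qed.

Lemma has_C1_ext u u' ux ux' uy uy' :
  (forall x y, D (x, y) -> u x y = u' x y) ->
  (forall x y, D (x, y) -> ux x y = ux' x y) ->
  (forall x y, D (x, y) -> uy x y = uy' x y) ->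
  has_C1 D u ux uy -> has_C1 D u' ux' uy'.
Proof.
  intros E Ex Ey Hu x y Hp; destruct (Hu x y Hp) as (H1 & H2 & H3 & H4).
  assert (L := open_locally_2d D x y Ho Hp).
  rewrite <- Ex, <- Ey by auto; split; [|split; [|split]].
  - refine (is_derive_ext_loc _ _ _ _ _ H1).
    apply filter_imp with (2 := locally_2d_1d_const_y _ _ _ L); auto.
  - refine (is_derive_ext_loc _ _ _ _ _ H2).
    apply filter_imp with (2 := locally_2d_1d_const_x _ _ _ L); auto.
  - apply continuity_2d_pt_ext_loc with (2 := H3).
    apply locally_2d_impl with (2 := L), locally_2d_forall; auto.
  - apply continuity_2d_pt_ext_loc with (2 := H4).
    apply locally_2d_impl with (2 := L), locally_2d_forall; auto.
Qed.

Lemma has_C1_const c : has_C1 D (fun _ _ => c) (fun _ _ => 0) (fun _ _ => 0).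
Proof.
  intros x y _; split; [|split; [|split]]; try apply (is_derive_const c);
    apply continuity_2d_pt_const.
Qed.

Lemma has_C1_fst : has_C1 D (fun x _ => x) (fun _ _ => 1) (fun _ _ => 0).
Proof.
  intros x y _; split; [|split; [|split]]; try apply continuity_2d_pt_const.
  - apply (is_derive_id x).
  - apply (is_derive_const x).
Qed.

Lemma has_C1_snd : has_C1 D (fun _ y => y) (fun _ _ => 0) (fun _ _ => 1).
Proof.
  intros x y _; split; [|split; [|split]]; try apply continuity_2d_pt_const.
  - apply (is_derive_const y).
  - apply (is_derive_id y).
Qed.

Lemma has_C1_plus u ux uy v vx vy :
  has_C1 D u ux uy -> has_C1 D v vx vy ->
  has_C1 D (fun x y => u x y + v x y) (fun x y => ux x y + vx x y)
    (fun x y => uy x y + vy x y).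
Proof.
  intros Hu Hv x y Hp.
  destruct (Hu x y Hp) as (H1 & H2 & H3 & H4), (Hv x y Hp) as (K1 & K2 & K3 & K4).
  split; [|split; [|split]].
  - apply (is_derive_plus (fun s => u s y) (fun s => v s y)); auto.
  - apply (is_derive_plus (fun s => u x s) (fun s => v x s)); auto.
  - now apply continuity_2d_pt_plus.
  - now apply continuity_2d_pt_plus.
Qed.

Lemma has_C1_mult u ux uy v vx vy :
  has_C1 D u ux uy -> has_C1 D v vx vy ->
  has_C1 D (fun x y => u x y * v x y) (fun x y => ux x y * v x y + u x y * vx x y)
    (fun x y => uy x y * v x y + u x y * vy x y).
Proof.
  intros Hu Hv x y Hp.
  assert (Cu := has_C1_continuity _ _ _ x y Hu Hp).
  assert (Cv := has_C1_continuity _ _ _ x y Hv Hp).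
  destruct (Hu x y Hp) as (H1 & H2 & H3 & H4), (Hv x y Hp) as (K1 & K2 & K3 & K4).
  split; [|split; [|split]].
  - apply (is_derive_mult (fun s => u s y) (fun s => v s y)); auto using Rmult_comm.
  - apply (is_derive_mult (fun s => u x s) (fun s => v x s)); auto using Rmult_comm.
  - apply continuity_2d_pt_plus; now apply continuity_2d_pt_mult.
  - apply continuity_2d_pt_plus; now apply continuity_2d_pt_mult.
Qed.

Lemma has_C1_comp (phi dphi : R -> R) u ux uy :
  has_C1 D u ux uy ->
  (forall x y, D (x, y) -> is_derive phi (u x y) (dphi (u x y)) /\
                           continuity_pt dphi (u x y)) ->
  has_C1 D (fun x y => phi (u x y)) (fun x y => dphi (u x y) * ux x y)
    (fun x y => dphi (u x y) * uy x y).
Proof.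
  intros Hu Hphi x y Hp.
  assert (Cu := has_C1_continuity _ _ _ x y Hu Hp).
  destruct (Hu x y Hp) as (H1 & H2 & H3 & H4), (Hphi x y Hp) as (K1 & K2).
  split; [|split; [|split]].
  - rewrite Rmult_comm; apply (is_derive_comp phi (fun s => u s y)); auto.
  - rewrite Rmult_comm; apply (is_derive_comp phi (fun s => u x s)); auto.
  - apply continuity_2d_pt_mult; auto; now apply continuity_1d_2d_pt_comp.
  - apply continuity_2d_pt_mult; auto; now apply continuity_1d_2d_pt_comp.
Qed.

Lemma has_C1_inv u ux uy :
  has_C1 D u ux uy -> (forall x y, D (x, y) -> u x y <> 0) ->
  has_C1 D (fun x y => / u x y) (fun x y => - / (u x y) ^ 2 * ux x y)
    (fun x y => - / (u x y) ^ 2 * uy x y).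
Proof.
  intros Hu Hn; apply (has_C1_comp Rinv (fun z => - / z ^ 2)); auto.
  intros x y Hp; specialize (Hn x y Hp); split.
  - auto_derive; auto; field; auto.
  - apply continuity_pt_opp, continuity_pt_inv.
    + apply derivable_continuous_pt, derivable_pt_pow.
    + now apply pow_nonzero.
Qed.

Lemma has_C1_sqrt u ux uy :
  has_C1 D u ux uy -> (forall x y, D (x, y) -> 0 < u x y) ->
  has_C1 D (fun x y => sqrt (u x y)) (fun x y => / (2 * sqrt (u x y)) * ux x y)
    (fun x y => / (2 * sqrt (u x y)) * uy x y).
Proof.
  intros Hu Hn; apply (has_C1_comp sqrt (fun z => / (2 * sqrt z))); auto.
  intros x y Hp; specialize (Hn x y Hp).
  assert (Hs := sqrt_lt_R0 _ Hn); split.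
  - auto_derive; auto; field; lra.
  - apply continuity_pt_inv; [|lra].
    apply continuity_pt_mult.
    + now apply continuity_pt_const.
    + apply continuity_pt_sqrt; lra.
Qed.

Lemma has_C1_Dx u ux uy (x y : R) :
  has_C1 D u ux uy -> D (x, y) -> Dx u x y = ux x y.
Proof. intros Hu Hp; apply is_derive_unique, (Hu x y Hp). Qed.

Lemma has_C1_Dy u ux uy (x y : R) :
  has_C1 D u ux uy -> D (x, y) -> Dy u x y = uy x y.
Proof. intros Hu Hp; apply is_derive_unique, (Hu x y Hp). Qed.

Lemma Ck_continuity k u x y : Ck k D u -> D (x, y) -> continuity_2d_pt u x y.
Proof. intros Hu Hp; specialize (Hu x y Hp); destruct k; apply Hu. Qed.

Lemma Ck_Dx k u : Ck (S k) D u -> Ck k D (Dx u).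
Proof. intros Hu x y Hp; apply (Hu x y Hp). Qed.

Lemma Ck_Dy k u : Ck (S k) D u -> Ck k D (Dy u).
Proof. intros Hu x y Hp; apply (Hu x y Hp). Qed.

Lemma Ck_has_C1 k u : Ck (S k) D u -> has_C1 D u (Dx u) (Dy u).
Proof.
  intros Hu x y Hp; destruct (Hu x y Hp) as (_ & H1 & H2 & _).
  split; [|split; [|split]].
  - now apply Derive_correct.
  - now apply Derive_correct.
  - apply (Ck_continuity k); auto; now apply Ck_Dx.
  - apply (Ck_continuity k); auto; now apply Ck_Dy.
Qed.

Lemma Ck_ext k u v :
  (forall x y, D (x, y) -> u x y = v x y) -> Ck k D u -> Ck k D v.
Proof.
  intros E Hu x y Hp; apply ex_diff_n_ext_loc with (2 := Hu x y Hp).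
  apply locally_2d_impl with (2 := open_locally_2d D x y Ho Hp), locally_2d_forall; auto.
Qed.

Lemma has_C1_Ck k u ux uy :
  has_C1 D u ux uy -> Ck k D ux -> Ck k D uy -> Ck (S k) D u.
Proof.
  intros Hu Hx Hy.
  assert (Kx : Ck k D (Dx u))
    by (apply Ck_ext with ux; auto; intros; symmetry; eapply has_C1_Dx; eauto).
  assert (Ky : Ck k D (Dy u))
    by (apply Ck_ext with uy; auto; intros; symmetry; eapply has_C1_Dy; eauto).
  intros x y Hp; split; [eapply has_C1_continuity; eauto|].
  destruct (Hu x y Hp) as (H1 & H2 & _).
  split; [|split; [|split]];
    [now exists (ux x y) | now exists (uy x y) | now apply Kx | now apply Ky].
Qed.

Lemma has_C1_Ck_1 u ux uy : has_C1 D u ux uy -> Ck 1 D u.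
Proof.
  intros Hu; apply (has_C1_Ck 0 u ux uy); auto; intros x y Hp; split; auto; apply (Hu x y Hp).
Qed.

Lemma Ck_mixed u x y : Ck 2 D u -> D (x, y) -> Dx (Dy u) x y = Dy (Dx u) x y.
Proof.
  intros Hu Hp; apply (Schwarz u x y).
  - apply locally_2d_impl with (2 := open_locally_2d D x y Ho Hp), locally_2d_forall.
    intros a b Hab; destruct (Hu a b Hab) as (_ & H1 & H2 & H3 & H4).
    split; [|split; [|split]]; [exact H1 | exact H2 | apply H4 | apply H3].
  - apply (Ck_continuity 0 (Dx (Dy u))); auto; now apply Ck_Dx, Ck_Dy.
  - apply (Ck_continuity 0 (Dy (Dx u))); auto; now apply Ck_Dy, Ck_Dx.
Qed.

End C1.

Lemma continuity_2d_pt_continuous_fst f x y :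
  continuity_2d_pt f x y -> continuous (fun s => f s y) x.
Proof.
  intros H; apply continuity_pt_filterlim, continuity_pt_locally; intros eps.
  exact (locally_2d_1d_const_y _ _ _ (H eps)).
Qed.

Lemma continuity_2d_pt_continuous_snd f x y :
  continuity_2d_pt f x y -> continuous (fun s => f x s) y.
Proof.
  intros H; apply continuity_pt_filterlim, continuity_pt_locally; intros eps.
  exact (locally_2d_1d_const_x _ _ _ (H eps)).
Qed.

(** * Poincaré lemma *)

Lemma between_ball (c r a b z : R) :
  Rabs (a - c) < r -> Rabs (b - c) < r -> Rmin a b <= z <= Rmax a b -> Rabs (z - c) < r.
Proof.
  intros Ha Hb; apply Rabs_def2 in Ha; apply Rabs_def2 in Hb.
  unfold Rmin, Rmax; destruct Rle_dec; intros Hz; apply Rabs_def1; lra.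
Qed.

Lemma derive_zero_const (f : R -> R) a b :
  (forall z, Rmin a b <= z <= Rmax a b -> is_derive f z 0) -> f a = f b.
Proof.
  intros Hf; destruct (MVT_gen f a b (fun _ => 0)) as (c & _ & E).
  - intros z Hz; apply Hf; lra.
  - intros z Hz; apply continuity_pt_filterlim, (ex_derive_continuous f).
    exists 0; apply Hf; lra.
  - lra.
Qed.

Lemma locally_Rabs_lt (c r x : R) : Rabs (x - c) < r -> locally x (fun t => Rabs (t - c) < r).
Proof.
  intros Hx; assert (He : 0 < r - Rabs (x - c)) by lra.
  exists (mkposreal _ He); intros t Bt; apply (Rabs_lt_between' t x) in Bt; simpl in Bt.
  revert Hx Bt; clear He; unfold Rabs; repeat destruct Rcase_abs; lra.
Qed.

(** The integral of the form P dx + Q dy from [a] to [b], along a horizontal leg followed by a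
    vertical one. *)
Definition corner_integral (P Q : R -> R -> R) (a b : R * R) : R :=
  RInt (fun s => P s (snd a)) (fst a) (fst b) + RInt (fun s => Q (fst b) s) (snd a) (snd b).

Section Corner.
Variables (D : R * R -> Prop) (P Px Py Q Qx Qy : R -> R -> R) (p0 : R * R) (r : R).
Hypothesis Ho : open D.
Hypothesis HP : has_C1 D P Px Py.
Hypothesis HQ : has_C1 D Q Qx Qy.
Hypothesis Hclosed : forall x y, D (x, y) -> Qx x y = Py x y.
Hypothesis HD : forall z, ball p0 r z -> D z.

Let in_D x y : Rabs (x - fst p0) < r -> Rabs (y - snd p0) < r -> D (x, y).
Proof. intros; apply HD, ball_plane; auto. Qed.

(** Closedness enters here. Moving the end point horizontally moves the whole vertical leg, whose
    integral changes at the rate of the integral of [Qx = Py], that is [P x y - P x a2]; the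
    horizontal leg supplies the missing [P x a2]. *)
Lemma corner_integral_Dx a x y : ball p0 r a -> ball p0 r (x, y) ->
  is_derive (fun s => corner_integral P Q a (s, y)) x (P x y).
Proof.
  intros Ba Bx.
  destruct a as [a1 a2], (proj1 (ball_plane _ _ _) Ba) as [A1 A2],
    (proj1 (ball_plane _ _ _) Bx) as [X1 X2].
  unfold corner_integral; simpl fst in *; simpl snd in *.
  assert (E : P x y = P x a2 + RInt (fun t => Derive (fun s => Q s t) x) a2 y).
  { rewrite (RInt_ext _ (fun t => Py x t)).
    - rewrite (is_RInt_unique _ _ _ (minus (P x y) (P x a2))).
      + unfold minus, plus, opp; simpl; ring.
      + apply (is_RInt_derive (fun t => P x t)); intros z Hz;
          assert (Hxz : D (x, z)) by (apply in_D; auto; apply between_ball with (3 := Hz); auto).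
        * apply (HP x z Hxz).
        * apply continuity_2d_pt_continuous_snd, (HP x z Hxz).
    - intros z [Hz1 Hz2].
      assert (Hxz : D (x, z))
        by (apply in_D; auto;
            apply between_ball with (3 := conj (Rlt_le _ _ Hz1) (Rlt_le _ _ Hz2)); auto).
      rewrite <- Hclosed by auto; now apply (has_C1_Dx D Q Qx Qy). }
  rewrite E.
  apply (is_derive_plus (fun s => RInt (fun t => P t a2) a1 s)
           (fun s => RInt (fun t => Q s t) a2 y)).
  - apply (is_derive_RInt (fun t => P t a2) _ a1).
    + apply filter_imp with (2 := locally_Rabs_lt _ _ _ X1); intros t Ht.
      apply (RInt_correct (fun t => P t a2)), (ex_RInt_continuous (fun t => P t a2)); intros z Hz.
      apply continuity_2d_pt_continuous_fst, (has_C1_continuity D Ho P Px Py); auto.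
      apply in_D; auto; apply between_ball with (3 := Hz); auto.
    + apply continuity_2d_pt_continuous_fst, (has_C1_continuity D Ho P Px Py); auto.
  - apply (is_derive_RInt_param (fun s t => Q s t)).
    + apply filter_imp with (2 := locally_Rabs_lt _ _ _ X1); intros s Hs t Ht.
      exists (Qx s t); apply HQ, in_D; auto; apply between_ball with (3 := Ht); auto.
    + intros t Ht.
      assert (Hxt : D (x, t)) by (apply in_D; auto; apply between_ball with (3 := Ht); auto).
      apply continuity_2d_pt_ext_loc with Qx; [|now apply HQ].
      apply locally_2d_impl with (2 := open_locally_2d D x t Ho Hxt), locally_2d_forall.
      intros u v Huv; symmetry; now apply (has_C1_Dx D Q Qx Qy).
    + apply filter_imp with (2 := locally_Rabs_lt _ _ _ X1); intros s Hs.
      apply (ex_RInt_continuous (fun t => Q s t)); intros z Hz.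
      apply continuity_2d_pt_continuous_snd, (has_C1_continuity D Ho Q Qx Qy); auto.
      apply in_D; auto; apply between_ball with (3 := Hz); auto.
Qed.

Lemma corner_integral_Dy a x y : ball p0 r a -> ball p0 r (x, y) ->
  is_derive (fun s => corner_integral P Q a (x, s)) y (Q x y).
Proof.
  intros Ba Bx.
  destruct a as [a1 a2], (proj1 (ball_plane _ _ _) Ba) as [A1 A2],
    (proj1 (ball_plane _ _ _) Bx) as [X1 X2].
  unfold corner_integral; simpl fst in *; simpl snd in *.
  replace (Q x y) with (0 + Q x y) by ring.
  apply (is_derive_plus (fun _ => RInt (fun t => P t a2) a1 x)
           (fun s => RInt (fun t => Q x t) a2 s));
    [apply (is_derive_const (RInt (fun t => P t a2) a1 x : R_NormedModule))|].
  apply (is_derive_RInt (fun t => Q x t) _ a2).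
  - apply filter_imp with (2 := locally_Rabs_lt _ _ _ X2); intros t Ht.
    apply (RInt_correct (fun t => Q x t)), (ex_RInt_continuous (fun t => Q x t)); intros z Hz.
    apply continuity_2d_pt_continuous_snd, (has_C1_continuity D Ho Q Qx Qy); auto.
    apply in_D; auto; apply between_ball with (3 := Hz); auto.
  - apply continuity_2d_pt_continuous_snd, (has_C1_continuity D Ho Q Qx Qy); auto.
Qed.

(** The corner integrals from [a] and from [b] have the same partial derivatives, so their
    difference [w] does not change along the corner from [b] to [c]; at [b] it equals the corner
    integral from [a] to [b]. *)
Lemma corner_integral_additive a b c : ball p0 r a -> ball p0 r b -> ball p0 r c ->
  corner_integral P Q a c = corner_integral P Q a b + corner_integral P Q b c.
Proof.
  intros Ba Bb Bc.
  destruct b as [b1 b2], c as [c1 c2].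
  destruct (proj1 (ball_plane _ _ _) Bb) as [B1 B2], (proj1 (ball_plane _ _ _) Bc) as [C1 C2].
  simpl fst in *; simpl snd in *.
  pose (w z := corner_integral P Q a z - corner_integral P Q (b1, b2) z).
  assert (Hb : corner_integral P Q (b1, b2) (b1, b2) = 0).
  { unfold corner_integral; simpl; rewrite !RInt_point; unfold zero; simpl; ring. }
  assert (E1 : w (b1, b2) = w (c1, b2)).
  { apply (derive_zero_const (fun s => w (s, b2))); intros z Hz.
    assert (Bz : ball p0 r (z, b2))
      by (apply ball_plane; split; auto; apply between_ball with (3 := Hz); auto).
    replace 0 with (P z b2 - P z b2) by ring.
    apply (is_derive_minus (fun s => corner_integral P Q a (s, b2))
             (fun s => corner_integral P Q (b1, b2) (s, b2))); now apply corner_integral_Dx. }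
  assert (E2 : w (c1, b2) = w (c1, c2)).
  { apply (derive_zero_const (fun s => w (c1, s))); intros z Hz.
    assert (Bz : ball p0 r (c1, z))
      by (apply ball_plane; split; auto; apply between_ball with (3 := Hz); auto).
    replace 0 with (Q c1 z - Q c1 z) by ring.
    apply (is_derive_minus (fun s => corner_integral P Q a (c1, s))
             (fun s => corner_integral P Q (b1, b2) (c1, s))); now apply corner_integral_Dy. }
  unfold w in *; lra.
Qed.

End Corner.

(** Near each point the global potential of the corner integrals is a constant plus the corner
    integral from that point, whose partial derivatives are known. *)
Lemma poincare (D : R * R -> Prop) (P Px Py Q Qx Qy : R -> R -> R) :
  open D -> simply_connected D -> has_C1 D P Px Py -> has_C1 D Q Qx Qy ->
  (forall x y, D (x, y) -> Qx x y = Py x y) ->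
  exists g, has_C1 D g P Q.
Proof.
  intros Ho Hsc HP HQ Hcl.
  destruct (simply_connected_potential D (corner_integral P Q) Ho Hsc) as (g & Hg).
  { intros p Hp; destruct (Ho p Hp) as (r & Hr); exists r; intros a b c.
    now apply (corner_integral_additive D P Px Py Q Qx Qy). }
  exists (fun x y => g (x, y)); intros x y Hp.
  destruct (Hg _ Hp) as (r & Hr).
  assert (HD : forall z, ball (x, y) r z -> D z) by (intros z Bz; apply (Hr z Bz)).
  assert (B := ball_center (x, y) r).
  split; [|split; [|split]].
  - apply (is_derive_ext_loc (fun s => g (x, y) + corner_integral P Q (x, y) (s, y))).
    + exists r; intros s Bs; symmetry; apply Hr; split; [exact Bs | apply ball_center].
    + replace (P x y) with (0 + P x y) by ring.
      apply (is_derive_plus (fun _ => g (x, y)) (fun s => corner_integral P Q (x, y) (s, y)));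
        [apply (is_derive_const (g (x, y)))|].
      apply (corner_integral_Dx D P Px Py Q Qx Qy (x, y) r Ho HP HQ Hcl HD); auto.
  - apply (is_derive_ext_loc (fun s => g (x, y) + corner_integral P Q (x, y) (x, s))).
    + exists r; intros s Bs; symmetry; apply Hr; split; [apply ball_center | exact Bs].
    + replace (Q x y) with (0 + Q x y) by ring.
      apply (is_derive_plus (fun _ => g (x, y)) (fun s => corner_integral P Q (x, y) (x, s)));
        [apply (is_derive_const (g (x, y)))|].
      apply (corner_integral_Dy D P Q Qx Qy (x, y) r Ho HQ HD); auto.
  - now apply (has_C1_continuity D Ho P Px Py).
  - now apply (has_C1_continuity D Ho Q Qx Qy).
Qed.

(** * The Calabi potential *)

Section Calabi.
Variable D : R * R -> Prop.
Hypothesis Ho : open D.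
Hypothesis Hstar : star_shaped D.

(** The Calabi potential is twice the case [n = 1] with [k = sigma / delta ^ 2]. The exponent is
    free because each differentiation in [x] or [y] brings out one more factor [t]. *)
Definition radial_integral (n : nat) (k : R -> R -> R) (x y : R) : R :=
  RInt (fun t => t ^ n * k (t * x) (t * y)) 0 1.

Lemma continuity_2d_pt_fst_mult k c x t :
  continuity_2d_pt k (t * x) (t * c) ->
  continuity_2d_pt (fun u v => k (v * u) (v * c)) x t.
Proof.
  intros Hk; apply (continuity_2d_pt_comp k (fun u v => v * u) (fun u v => v * c)); auto;
    apply continuity_2d_pt_mult; try apply continuity_2d_pt_id1; try apply continuity_2d_pt_id2;
    apply continuity_2d_pt_const.
Qed.

Lemma continuity_2d_pt_pow_snd n x t : continuity_2d_pt (fun _ v => v ^ n) x t.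
Proof.
  apply (continuity_1d_2d_pt_comp (fun v => v ^ n) (fun _ v => v)).
  - apply derivable_continuous_pt, derivable_pt_pow.
  - apply continuity_2d_pt_id2.
Qed.

Lemma ex_RInt_radial n k x y :
  (forall a b, D (a, b) -> continuity_2d_pt k a b) -> D (x, y) ->
  ex_RInt (fun t => t ^ n * k (t * x) (t * y)) 0 1.
Proof.
  intros Hk Hp; apply (ex_RInt_continuous (fun t => t ^ n * k (t * x) (t * y))).
  rewrite Rmin_left, Rmax_right by lra; intros t Ht.
  apply (continuity_2d_pt_continuous_snd (fun u v => v ^ n * k (v * u) (v * y))).
  apply continuity_2d_pt_mult; [apply continuity_2d_pt_pow_snd|].
  apply continuity_2d_pt_fst_mult, Hk, Hstar; auto.
Qed.

(** Continuity of [k] along the segment from the origin to [(x, y)], made uniform in [t] by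
    compactness of the unit interval. *)
Lemma radial_equicontinuous k x y (eps : posreal) :
  (forall a b, D (a, b) -> continuity_2d_pt k a b) -> D (x, y) ->
  locally_2d (fun u v => forall t, 0 <= t <= 1 ->
    Rabs (k (t * u) (t * v) - k (t * x) (t * y)) < eps) x y.
Proof.
  intros Hk Hp.
  (* Chosen so that in [s * w - t * z = s * (w - z) + (s - t) * z], with [z] equal to [x] or [y],
     deviations below [d / M] add up to less than [d / M + d / M * (M - 1) = d]. *)
  pose (M := 1 + Rabs x + Rabs y).
  assert (HM : 0 < M) by (unfold M; assert (A := Rabs_pos x); assert (B := Rabs_pos y); lra).
  assert (Hloc : forall t, exists e : posreal, 0 <= t <= 1 ->
    forall s u v, 0 <= s <= 1 -> Rabs (s - t) < e -> Rabs (u - x) < e -> Rabs (v - y) < e ->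
    Rabs (k (s * u) (s * v) - k (t * x) (t * y)) < eps / 2).
  { intros t; destruct (classic (0 <= t <= 1)) as [Ht|Ht]; [|now exists eps].
    destruct (Hk (t * x) (t * y) (proj2 Hstar x y t Hp Ht) (mkposreal _ (is_pos_div_2 eps)))
      as (d & Hd); simpl in Hd.
    assert (He : 0 < d / M) by (apply Rdiv_lt_0_compat; auto; apply cond_pos).
    exists (mkposreal _ He); simpl; intros _ s u v Hs Hst Hu Hv.
    assert (Hb : forall w z, Rabs z <= M - 1 -> Rabs (w - z) < d / M -> Rabs (s * w - t * z) < d).
    { intros w z Hz Hw.
      replace (s * w - t * z) with (s * (w - z) + (s - t) * z) by ring.
      apply Rle_lt_trans with (1 := Rabs_triang _ _); rewrite !Rabs_mult.
      assert (A1 : Rabs s <= 1) by (apply Rabs_le; lra).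
      assert (A2 : Rabs s * Rabs (w - z) <= 1 * Rabs (w - z))
        by (apply Rmult_le_compat_r; auto using Rabs_pos).
      assert (A3 : Rabs (s - t) * Rabs z <= d / M * (M - 1))
        by (apply Rmult_le_compat; auto using Rabs_pos; lra).
      assert (A4 : d / M * (M - 1) = d - d / M) by (field; lra).
      lra. }
    assert (Ax := Rabs_pos x); assert (Ay := Rabs_pos y).
    apply Hd; apply Hb; auto; unfold M; lra. }
  pose (delta t := proj1_sig (constructive_indefinite_description _ (Hloc t))).
  destruct (compactness_value_1d 0 1 delta) as (d & Hd).
  exists d; intros u v Hu Hv s Hs.
  specialize (Hd s Hs); apply NNPP in Hd; destruct Hd as (t & Ht & Hst & Hdt).
  unfold delta in *; destruct constructive_indefinite_description as [e He]; simpl in *.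
  specialize (He Ht).
  assert (B1 := He s u v Hs Hst ltac:(lra) ltac:(lra)).
  assert (B2 : Rabs (k (s * x) (s * y) - k (t * x) (t * y)) < eps / 2).
  { apply He; auto; rewrite Rminus_diag, Rabs_R0; apply cond_pos. }
  replace (k (s * u) (s * v) - k (s * x) (s * y))
    with ((k (s * u) (s * v) - k (t * x) (t * y))
          - (k (s * x) (s * y) - k (t * x) (t * y))) by ring.
  apply Rle_lt_trans with (1 := Rabs_triang _ _); rewrite Rabs_Ropp; lra.
Qed.

Lemma radial_integral_continuity n k x y :
  (forall a b, D (a, b) -> continuity_2d_pt k a b) -> D (x, y) ->
  continuity_2d_pt (radial_integral n k) x y.
Proof.
  intros Hk Hp eps.
  apply locally_2d_impl with (2 := open_locally_2d D x y Ho Hp).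
  apply locally_2d_impl
    with (2 := radial_equicontinuous k x y (mkposreal _ (is_pos_div_2 eps)) Hk Hp).
  apply locally_2d_forall; simpl; intros u v He Huv; unfold radial_integral.
  assert (Iu := ex_RInt_radial n k u v Hk Huv); assert (Ix := ex_RInt_radial n k x y Hk Hp).
  assert (E := RInt_minus _ _ 0 1 Iu Ix); unfold minus, plus, opp in E; simpl in E.
  unfold Rminus; rewrite <- E.
  apply Rle_lt_trans with ((1 - 0) * (eps / 2)); [|destruct eps; simpl; lra].
  apply abs_RInt_le_const; [lra|exact (ex_RInt_minus _ _ 0 1 Iu Ix)|].
  intros t Ht; specialize (He t Ht).
  replace (t ^ n * k (t * u) (t * v) + - (t ^ n * k (t * x) (t * y)))
    with (t ^ n * (k (t * u) (t * v) - k (t * x) (t * y))) by ring.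
  assert (Hn : Rabs (t ^ n) <= 1).
  { rewrite <- RPow_abs, Rabs_pos_eq by lra. rewrite <- (pow1 n); apply pow_incr; lra. }
  rewrite Rabs_mult, <- (Rmult_1_l (eps / 2)).
  apply Rmult_le_compat; auto using Rabs_pos; lra.
Qed.

Lemma radial_integral_Dx n k kx ky x y : has_C1 D k kx ky -> D (x, y) ->
  is_derive (fun s => radial_integral n k s y) x (radial_integral (S n) kx x y).
Proof.
  intros Hk Hp; unfold radial_integral.
  assert (Hd : forall u v, D (v * u, v * y) ->
    is_derive (fun s => v ^ n * k (v * s) (v * y)) u (v ^ S n * kx (v * u) (v * y))).
  { intros u v Hv; destruct (Hk _ _ Hv) as (K & _).
    replace (v ^ S n * kx (v * u) (v * y)) with (v ^ n * (v * kx (v * u) (v * y))) by (simpl; ring).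
    apply (is_derive_scal (fun s => k (v * s) (v * y))).
    apply (is_derive_comp (fun s => k s (v * y)) (fun s => v * s)); auto.
    auto_derive; auto; ring. }
  assert (L : locally x (fun s => D (s, y)))
    by exact (locally_2d_1d_const_y _ _ _ (open_locally_2d D x y Ho Hp)).
  rewrite (RInt_ext _ (fun t => Derive (fun s => t ^ n * k (t * s) (t * y)) x)).
  2:{ rewrite Rmin_left, Rmax_right by lra; intros t Ht; symmetry.
      apply is_derive_unique, Hd, Hstar; auto; lra. }
  apply (is_derive_RInt_param (fun s t => t ^ n * k (t * s) (t * y)));
    rewrite ?Rmin_left, ?Rmax_right by lra.
  - apply filter_imp with (2 := L); intros s Hs t Ht.
    eexists; apply Hd, Hstar; auto.
  - intros t Ht.
    assert (Hxt : D (t * x, t * y)) by (apply Hstar; auto).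
    apply continuity_2d_pt_ext_loc with (fun u v => v ^ S n * kx (v * u) (v * y)).
    + assert (Lt : locally_2d (fun u v => D (v * u, v * y)) x t).
      { destruct (open_locally_2d D _ _ Ho Hxt) as (e & He).
        assert (C : continuity_2d_pt (fun u v : R => v * u) x t)
          by (apply continuity_2d_pt_mult;
              [apply continuity_2d_pt_id2 | apply continuity_2d_pt_id1]).
        assert (C' : continuity_2d_pt (fun _ v : R => v * y) x t)
          by (apply continuity_2d_pt_mult;
              [apply continuity_2d_pt_id2 | apply continuity_2d_pt_const]).
        apply locally_2d_impl with (2 := C e), locally_2d_impl with (2 := C' e).
        apply locally_2d_forall; auto. }
      apply locally_2d_impl with (2 := Lt), locally_2d_forall.
      intros u v Huv; symmetry; now apply is_derive_unique, Hd.
    + apply continuity_2d_pt_mult; [apply continuity_2d_pt_pow_snd|].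
      apply continuity_2d_pt_fst_mult, Hk, Hxt.
  - apply filter_imp with (2 := L); intros s Hs.
    apply (ex_RInt_radial n k s y); auto; intros; eapply has_C1_continuity; eauto.
Qed.

(** With the two swap lemmas that follow, it yields the derivative in [y] from [radial_integral_Dx]
    by exchanging the coordinates. *)
Lemma star_shaped_swap : star_shaped (fun p => D (snd p, fst p)).
Proof. split; [apply Hstar | intros x y t; apply Hstar]. Qed.

End Calabi.

Lemma open_swap (D : R * R -> Prop) : open D -> open (fun p => D (snd p, fst p)).
Proof.
  intros Ho [a b] Hp; destruct (Ho _ Hp) as (e & He).
  exists e; intros q [B1 B2]; apply He; now split.
Qed.

Lemma has_C1_swap D u ux uy : has_C1 D u ux uy ->
  has_C1 (fun p => D (snd p, fst p)) (fun x y => u y x) (fun x y => uy y x) (fun x y => ux y x).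
Proof.
  intros Hu x y Hp; destruct (Hu y x Hp) as (H1 & H2 & H3 & H4).
  split; [|split; [|split]]; auto; intros eps.
  - destruct (H4 eps) as (d & Hd); exists d; auto.
  - destruct (H3 eps) as (d & Hd); exists d; auto.
Qed.

Lemma radial_integral_C1 D n k kx ky : open D -> star_shaped D -> has_C1 D k kx ky ->
  has_C1 D (radial_integral n k) (radial_integral (S n) kx) (radial_integral (S n) ky).
Proof.
  intros Ho Hs Hk x y Hp; split; [|split; [|split]].
  - now apply (radial_integral_Dx D Ho Hs n k kx ky).
  - apply (radial_integral_Dx _ (open_swap D Ho) (star_shaped_swap D Hs) n
             (fun x y => k y x) (fun x y => ky y x) (fun x y => kx y x)); auto.
    now apply has_C1_swap.
  - apply (radial_integral_continuity D); auto; intros; now apply Hk.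
  - apply (radial_integral_continuity D); auto; intros; now apply Hk.
Qed.

(** The three integrands add up to the derivative in [t] of [t ^ 2 * k (t * x) (t * y)], which runs
    from 0 to [k x y]. *)
Lemma radial_euler D k kx ky x y : open D -> star_shaped D -> has_C1 D k kx ky -> D (x, y) ->
  2 * radial_integral 1 k x y
    + x * radial_integral 2 kx x y + y * radial_integral 2 ky x y = k x y.
Proof.
  intros Ho Hs Hk Hp.
  assert (Ck := fun a b => has_C1_continuity D Ho k kx ky a b Hk).
  assert (Ckx := fun a b Hab => proj1 (proj2 (proj2 (Hk a b Hab)))).
  assert (Cky := fun a b Hab => proj2 (proj2 (proj2 (Hk a b Hab)))).
  assert (I0 := RInt_correct _ _ _ (ex_RInt_radial D Hs 1 k x y Ck Hp)).
  assert (I1 := RInt_correct _ _ _ (ex_RInt_radial D Hs 2 kx x y Ckx Hp)).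
  assert (I2 := RInt_correct _ _ _ (ex_RInt_radial D Hs 2 ky x y Cky Hp)).
  assert (I := is_RInt_plus _ _ _ _ _ _
                 (is_RInt_plus _ _ _ _ _ _ (is_RInt_scal _ _ _ 2 _ I0) (is_RInt_scal _ _ _ x _ I1))
                 (is_RInt_scal _ _ _ y _ I2)).
  unfold plus, scal in I; simpl in I; unfold mult in I; simpl in I.
  fold (radial_integral 1 k x y) in I.
  change (fun x0 : R =>
         2 * (x0 * 1 * k (x0 * x) (x0 * y)) +
         x * (x0 * (x0 * 1) * kx (x0 * x) (x0 * y)) +
         y * (x0 * (x0 * 1) * ky (x0 * x) (x0 * y)))
   with (fun t : R => 2 * (t * 1 * k (t * x) (t * y)) +
         x * (t * (t * 1) * kx (t * x) (t * y)) +
         y * (t * (t * 1) * ky (t * x) (t * y))) in I.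
  apply is_RInt_unique in I.
  transitivity (RInt (fun t : R => 2 * (t * 1 * k (t * x) (t * y)) +
         x * (t * (t * 1) * kx (t * x) (t * y)) +
         y * (t * (t * 1) * ky (t * x) (t * y))) 0 1); [symmetry; exact I|].
  clear I I0 I1 I2.
  set (F := fun t : R => _).
  rewrite (is_RInt_unique F 0 1 (minus (1 ^ 2 * k (1 * x) (1 * y)) (0 ^ 2 * k (0 * x) (0 * y)))).
  { unfold minus, plus, opp; simpl; rewrite !Rmult_1_l; ring. }
  apply (is_RInt_derive (fun t => t ^ 2 * k (t * x) (t * y)));
    rewrite Rmin_left, Rmax_right by lra; intros t Ht;
    assert (Htp : D (t * x, t * y)) by (apply Hs; auto).
  - assert (Hd : is_derive (fun t => k (t * x) (t * y)) t
                   (kx (t * x) (t * y) * x + ky (t * x) (t * y) * y)).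
    { apply is_derive_Reals, (derivable_pt_lim_comp_2d k (fun t => t * x) (fun t => t * y)).
      - now apply (has_C1_differentiable D).
      - apply is_derive_Reals; auto_derive; auto; ring.
      - apply is_derive_Reals; auto_derive; auto; ring. }
    replace (F t) with (2 * t * k (t * x) (t * y)
        + t ^ 2 * (kx (t * x) (t * y) * x + ky (t * x) (t * y) * y)) by (unfold F; ring).
    apply (is_derive_mult (fun t => t ^ 2) (fun t => k (t * x) (t * y))); auto using Rmult_comm.
    auto_derive; auto; ring.
  - unfold F; apply (continuity_2d_pt_continuous_snd (fun u v : R =>
         2 * (v * 1 * k (v * u) (v * y)) +
         x * (v * (v * 1) * kx (v * u) (v * y)) +
         y * (v * (v * 1) * ky (v * u) (v * y)))).
    repeat first [ apply continuity_2d_pt_const | apply continuity_2d_pt_id2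
                 | apply continuity_2d_pt_fst_mult; auto
                 | apply continuity_2d_pt_plus | apply continuity_2d_pt_mult ].
Qed.

(** The identity is [radial_euler] doubled. Its left side is the divergence of the vector field (x
    C, y C), equivalently the curl of (- y C, x C), the form in which it meets the slopes. *)
Lemma calabi_C1 D delta sigma :
  open D -> star_shaped D -> smooth D delta -> (forall x y, D (x, y) -> 0 < delta x y) ->
  Ck 2 D sigma ->
  exists Cx Cy, has_C1 D (calabi delta sigma) Cx Cy /\
    forall x y, D (x, y) ->
      2 * calabi delta sigma x y + x * Cx x y + y * Cy x y = 2 * sigma x y / delta x y ^ 2.
Proof.
  intros Ho Hs Hd Hpos Hsig.
  pose (k x y := sigma x y / delta x y ^ 2).
  assert (Sk : exists kx ky, has_C1 D k kx ky).
  { assert (Sd := Ck_has_C1 D 1 delta (Hd 2%nat)); assert (Ss := Ck_has_C1 D 1 sigma Hsig).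
    do 2 eexists.
    refine (has_C1_mult D Ho _ _ _ _ _ _ Ss (has_C1_inv D Ho (fun x y => delta x y ^ 2) _ _ _ _)).
    - exact (has_C1_mult D Ho _ _ _ _ _ _ Sd (has_C1_mult D Ho _ _ _ _ _ _ Sd (has_C1_const D 1))).
    - intros x y Hp; specialize (Hpos x y Hp); apply pow_nonzero; lra. }
  destruct Sk as (kx & ky & Sk).
  exists (fun x y => 2 * radial_integral 2 kx x y), (fun x y => 2 * radial_integral 2 ky x y).
  assert (Sr := radial_integral_C1 D 1 _ _ _ Ho Hs Sk).
  assert (E : forall x y, calabi delta sigma x y = 2 * radial_integral 1 k x y).
  { intros x y; unfold calabi, radial_integral; f_equal; apply RInt_ext; intros t _;
    unfold k; now rewrite pow_1. }
  split.
  - refine (has_C1_ext D Ho _ _ _ _ _ _ _ _ _ (has_C1_mult D Ho _ _ _ _ _ _ (has_C1_const D 2) Sr));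
      intros; cbv beta; rewrite ?E; ring.
  - intros x y Hp; rewrite E.
    assert (Q := radial_euler D _ _ _ x y Ho Hs Sk Hp).
    replace (2 * sigma x y / delta x y ^ 2) with (2 * k x y) by (unfold k, Rdiv; ring).
    rewrite <- Q; ring.
Qed.

(** * Mean curvature of graphs in divergence form *)

(** For [eps = 1] the slopes are [alpha] and [beta] and [area_sq] is the square of [omega]; for
    [eps = -1] they are the primed slopes and the expression under the root in [omega']. *)
Definition slope_x (eps : R) (delta sigma u : R -> R -> R) (x y : R) : R :=
  Dx u x y + eps * y * calabi delta sigma x y.
Definition slope_y (eps : R) (delta sigma u : R -> R -> R) (x y : R) : R :=
  Dy u x y - eps * x * calabi delta sigma x y.
Definition area_sq (eps : R) (delta sigma u : R -> R -> R) (x y : R) : R :=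
  1 + eps * delta x y ^ 2 *
    (slope_x eps delta sigma u x y ^ 2 + slope_y eps delta sigma u x y ^ 2).

(** On a tangent vector of the graph the connection form, whose square is the second part of the
    metric, takes the value a V1 + b V2 with the slopes a, b as coefficients. *)
Lemma first_form_killing eps delta sigma u x y V W :
  first_form (killing_metric eps delta sigma) u x y V W =
  1 / delta x y ^ 2 * (fst V * fst W + snd V * snd W)
  + eps * ((slope_x eps delta sigma u x y * fst V + slope_y eps delta sigma u x y * snd V)
         * (slope_x eps delta sigma u x y * fst W + slope_y eps delta sigma u x y * snd W)).
Proof.
  unfold first_form, killing_metric, graph, graph_d, slope_x, slope_y; ring.
Qed.

(** The derivative along [v] of the coefficient [m w n] of [killing_metric], in terms of the
    first-order jets [d, dx, dy] of [delta] and [C, Cx, Cy] of the Calabi potential. *)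
Definition killing_metric_d (eps x y d dx dy C Cx Cy : R) (v w n : space) : R :=
  let '(v1, v2, _) := v in
  let '(w1, w2, w3) := w in
  let '(n1, n2, n3) := n in
  let dC := Cx * v1 + Cy * v2 in
  - 2 * (dx * v1 + dy * v2) / d ^ 3 * (w1 * n1 + w2 * n2)
  + eps * ((eps * dC * (y * w1 - x * w2) + eps * C * (v2 * w1 - v1 * w2))
             * (n3 + eps * C * (y * n1 - x * n2))
           + (w3 + eps * C * (y * w1 - x * w2))
             * (eps * dC * (y * n1 - x * n2) + eps * C * (v2 * n1 - v1 * n2))).

Lemma is_derive_along (k : R -> R -> R) x y kx ky v1 v2 :
  differentiable_pt_lim k x y kx ky ->
  is_derive (fun t => k (x + t * v1) (y + t * v2)) 0 (kx * v1 + ky * v2).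
Proof.
  intros Hk; apply is_derive_Reals.
  apply (derivable_pt_lim_comp_2d k (fun t => x + t * v1) (fun t => y + t * v2)).
  - now rewrite !Rmult_0_l, !Rplus_0_r.
  - apply is_derive_Reals; auto_derive; auto; ring.
  - apply is_derive_Reals; auto_derive; auto; ring.
Qed.

(** The coefficients do not depend on [z], so only the horizontal part of [v] contributes: this is
    the Killing property of the vertical field. *)
Lemma dir_derive_killing eps delta sigma x y z dx dy Cx Cy v w n :
  differentiable_pt_lim delta x y dx dy ->
  differentiable_pt_lim (calabi delta sigma) x y Cx Cy -> delta x y <> 0 ->
  dir_derive (fun q => killing_metric eps delta sigma q w n) (x, y, z) v
  = killing_metric_d eps x y (delta x y) dx dy (calabi delta sigma x y) Cx Cy v w n.
Proof.
  destruct v as [[v1 v2] v3], w as [[w1 w2] w3], n as [[n1 n2] n3]; intros Hd HC H0.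
  assert (Ld := is_derive_along _ _ _ _ _ v1 v2 Hd).
  assert (LC := is_derive_along _ _ _ _ _ v1 v2 HC).
  unfold dir_derive, killing_metric, killing_metric_d; apply is_derive_unique.
  set (C := calabi delta sigma) in *.
  (* Along the line both coefficient functions become functions of one variable, made opaque below
     so that [auto_derive] meets only their known derivatives at 0. *)
  pose (f t := delta (x + t * v1) (y + t * v2)); pose (c t := C (x + t * v1) (y + t * v2)).
  change (is_derive f 0 (dx * v1 + dy * v2)) in Ld.
  change (is_derive c 0 (Cx * v1 + Cy * v2)) in LC.
  apply (is_derive_ext (fun t : R => 1 / f t ^ 2 * (w1 * n1 + w2 * n2)
    + eps * ((w3 + eps * c t * ((y + t * v2) * w1 - (x + t * v1) * w2))
           * (n3 + eps * c t * ((y + t * v2) * n1 - (x + t * v1) * n2)))));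
    [intros t; reflexivity|].
  assert (Ef : f 0 = delta x y) by (unfold f; now rewrite !Rmult_0_l, !Rplus_0_r).
  assert (Ec : c 0 = C x y) by (unfold c; now rewrite !Rmult_0_l, !Rplus_0_r).
  clearbody f c.
  assert (Df : Derive (fun t : R => f t) 0 = dx * v1 + dy * v2) by now apply is_derive_unique.
  assert (Dc : Derive (fun t : R => c t) 0 = Cx * v1 + Cy * v2) by now apply is_derive_unique.
  assert (Xf : ex_derive f 0) by (eexists; exact Ld).
  assert (Xc : ex_derive c 0) by (eexists; exact LC).
  auto_derive.
  - rewrite Ef; repeat split; auto; apply Rmult_integral_contrapositive; split; auto; lra.
  - rewrite Df, Dc, Ef, Ec; field; auto.
Qed.

(** The normal in terms of [n], the value on it of the connection form. *)
Definition graph_normal (eps : R) (delta sigma u : R -> R -> R) (x y n : R) : space :=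
  let a := slope_x eps delta sigma u x y in
  let b := slope_y eps delta sigma u x y in
  let d := delta x y in
  (- eps * d ^ 2 * a * n, - eps * d ^ 2 * b * n,
   n + d ^ 2 * calabi delta sigma x y * (y * a - x * b) * n).

(** Orthogonality to the two coordinate tangent vectors determines the horizontal part of [N] from
    the value [n] of the connection form; the unit length gives [(n * w) ^ 2 = 1], and upwardness
    selects [n = / w]. Uniqueness is essential, as [has_mean_curvature] only provides some
    normal. *)
Lemma upward_unit_normal_killing eps delta sigma u x y N :
  eps = 1 \/ eps = -1 -> 0 < delta x y -> 0 < area_sq eps delta sigma u x y ->
  upward_unit_normal eps (killing_metric eps delta sigma) u x y N <->
  N = graph_normal eps delta sigma u x y (/ sqrt (area_sq eps delta sigma u x y)).
Proof.
  intros He Hd HW; assert (He2 : eps * eps = 1) by (destruct He; subst; ring).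
  assert (Hs := sqrt_lt_R0 _ HW); assert (Hs2 := sqrt_sqrt _ (Rlt_le _ _ HW)).
  set (w := sqrt (area_sq eps delta sigma u x y)) in *.
  unfold area_sq in Hs2.
  destruct N as [[n1 n2] n3].
  unfold upward_unit_normal, killing_metric, graph, graph_d, graph_normal.
  assert (Ex : Dx u x y = slope_x eps delta sigma u x y - eps * y * calabi delta sigma x y)
    by (unfold slope_x; ring).
  assert (Ey : Dy u x y = slope_y eps delta sigma u x y + eps * x * calabi delta sigma x y)
    by (unfold slope_y; ring).
  rewrite Ex, Ey; clear Ex Ey.
  set (a := slope_x eps delta sigma u x y) in *.
  set (b := slope_y eps delta sigma u x y) in *.
  set (d := delta x y) in *; set (C := calabi delta sigma x y) in *.
  clearbody w a b d C.
  assert (Hw : w <> 0) by lra; assert (Hd0 : d <> 0) by lra.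
  split.
  - intros (HV & HN & HU).
    assert (H1 := HV (1, 0)); assert (H2 := HV (0, 1)); clear HV; simpl fst in *; simpl snd in *.
    pose (n := n3 + eps * C * (y * n1 - x * n2)).
    assert (E1 : n1 = - eps * d ^ 2 * a * n).
    { apply Rmult_eq_reg_l with (1 / d ^ 2); [|apply Rgt_not_eq; apply Rdiv_lt_0_compat; nra].
      replace (1 / d ^ 2 * (- eps * d ^ 2 * a * n)) with (- eps * a * n) by (field; auto).
      unfold n; nra. }
    assert (E2 : n2 = - eps * d ^ 2 * b * n).
    { apply Rmult_eq_reg_l with (1 / d ^ 2); [|apply Rgt_not_eq; apply Rdiv_lt_0_compat; nra].
      replace (1 / d ^ 2 * (- eps * d ^ 2 * b * n)) with (- eps * b * n) by (field; auto).
      unfold n; nra. }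
    assert (E3 : n3 = n - eps * C * (y * n1 - x * n2)) by (unfold n; ring).
    assert (Hn : n = / w).
    { fold n in HN, HU.
      assert (P : 0 < n).
      { replace (eps * (1 / d ^ 2 * (n1 * 0 + n2 * 0)
                        + eps * (n * (1 + eps * C * (y * 0 - x * 0)))))
          with (eps * eps * n) in HU by ring.
        rewrite He2 in HU; lra. }
      rewrite E1, E2 in HN.
      replace (1 / d ^ 2 * (- eps * d ^ 2 * a * n * (- eps * d ^ 2 * a * n)
                 + - eps * d ^ 2 * b * n * (- eps * d ^ 2 * b * n)) + eps * (n * n))
        with (n * n * (eps * eps * d ^ 2 * (a ^ 2 + b ^ 2) + eps)) in HN by (field; auto).
      assert (Q : (n * w) * (n * w) = 1).
      { replace (n * w * (n * w)) with (n * n * (w * w)) by ring; rewrite Hs2.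
        (* Multiplying the length equation by [eps] makes its right side 1 and turns the bracket
           into [area_sq]. *)
        transitivity (eps * (n * n * (eps * eps * d ^ 2 * (a ^ 2 + b ^ 2) + eps)));
          [rewrite He2 | rewrite HN; auto].
        replace (eps * (n * n * (1 * d ^ 2 * (a ^ 2 + b ^ 2) + eps)))
          with (n * n * (eps * d ^ 2 * (a ^ 2 + b ^ 2) + eps * eps)) by ring.
        rewrite He2; ring. }
      assert (Pw : 0 < n * w) by now apply Rmult_lt_0_compat.
      assert (Q1 : n * w = 1) by nra.
      apply Rmult_eq_reg_r with w; auto; rewrite Q1; field; auto. }
    rewrite <- Hn; rewrite E3, E1, E2.
    f_equal; clear - He2.
    replace (n - eps * C * (y * (- eps * d ^ 2 * a * n) - x * (- eps * d ^ 2 * b * n)))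
      with (n + eps * eps * (d ^ 2 * C * (y * a - x * b) * n)) by ring.
    rewrite He2; ring.
  - intros E.
    assert (E1 : n1 = - eps * d ^ 2 * a * / w) by (injection E; auto).
    assert (E2 : n2 = - eps * d ^ 2 * b * / w) by (injection E; auto).
    assert (E3 : n3 = / w + d ^ 2 * C * (y * a - x * b) * / w) by (injection E; auto).
    clear E.
    assert (E3' : n3 + eps * C * (y * n1 - x * n2) = / w).
    { rewrite E1, E2, E3.
      replace (/ w + d ^ 2 * C * (y * a - x * b) * / w +
         eps * C * (y * (- eps * d ^ 2 * a * / w) - x * (- eps * d ^ 2 * b * / w)))
        with (/ w + (1 - eps * eps) * (d ^ 2 * C * (y * a - x * b) * / w)) by ring.
      rewrite He2; ring. }
    rewrite E3'; repeat split.
    + intros [V1 V2]; simpl; rewrite E1, E2; field; auto.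
    + rewrite E1, E2.
      replace (1 / d ^ 2 * (- eps * d ^ 2 * a * / w * (- eps * d ^ 2 * a * / w)
         + - eps * d ^ 2 * b * / w * (- eps * d ^ 2 * b * / w)) + eps * (/ w * / w))
        with (eps * (1 * (eps * d ^ 2 * (a ^ 2 + b ^ 2)) + 1) / (w * w)) by (field; auto).
      rewrite Hs2; field; intros Z; rewrite Z in Hs2; nra.
    + replace (eps * (1 / d ^ 2 * (n1 * 0 + n2 * 0)
                      + eps * (/ w * (1 + eps * C * (y * 0 - x * 0)))))
        with (eps * eps * / w) by ring.
      rewrite He2, Rmult_1_l; now apply Rinv_0_lt_compat.
Qed.

(** A direct computation: the trace is well defined because the determinant of the first form is
    [W / d ^ 4]. For [n] equal to [/ sqrt W], the right side is [d ^ 2] times the divergence of the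
    slope field divided by [sqrt W], expanded by the quotient rule. *)
Lemma trace_second_form_killing eps delta sigma u x y dx dy Cx Cy n :
  eps = 1 \/ eps = -1 ->
  differentiable_pt_lim delta x y dx dy ->
  differentiable_pt_lim (calabi delta sigma) x y Cx Cy -> delta x y <> 0 ->
  area_sq eps delta sigma u x y <> 0 ->
  let m := killing_metric eps delta sigma in
  let d := delta x y in
  let C := calabi delta sigma x y in
  let a := slope_x eps delta sigma u x y in
  let b := slope_y eps delta sigma u x y in
  let ax := Dx (Dx u) x y + eps * y * Cx in
  let ay := Dy (Dx u) x y + eps * (C + y * Cy) in
  let bx := Dy (Dx u) x y - eps * (C + x * Cx) in
  let b_y := Dy (Dy u) x y - eps * x * Cy in
  let W := area_sq eps delta sigma u x y in
  let Wx := eps * (2 * d * dx * (a ^ 2 + b ^ 2) + 2 * d ^ 2 * (a * ax + b * bx)) in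
  let Wy := eps * (2 * d * dy * (a ^ 2 + b ^ 2) + 2 * d ^ 2 * (a * ay + b * b_y)) in
  trace_wrt (first_form m u x y)
    (second_form eps m u x y (graph_normal eps delta sigma u x y n))
  = d ^ 2 * n * (ax + b_y - (a * Wx + b * Wy) / (2 * W)).
Proof.
  intros He Hd HC H0 HW; cbv zeta.
  unfold trace_wrt; rewrite !first_form_killing.
  unfold second_form, christoffel, graph.
  rewrite !(dir_derive_killing _ _ _ _ _ _ _ _ _ _ _ _ _ Hd HC H0).
  unfold graph_normal, graph_d, graph_d2, killing_metric, killing_metric_d.
  assert (Ex : Dx u x y = slope_x eps delta sigma u x y - eps * y * calabi delta sigma x y)
    by (unfold slope_x; ring).
  assert (Ey : Dy u x y = slope_y eps delta sigma u x y + eps * x * calabi delta sigma x y)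
    by (unfold slope_y; ring).
  rewrite Ex, Ey; clear Ex Ey Hd HC; unfold area_sq in *.
  set (a := slope_x eps delta sigma u x y) in *.
  set (b := slope_y eps delta sigma u x y) in *.
  set (d := delta x y) in *; set (C := calabi delta sigma x y) in *.
  set (uxx := Dx (Dx u) x y); set (uxy := Dy (Dx u) x y); set (uyy := Dy (Dy u) x y).
  clearbody a b d C uxx uxy uyy; cbn [fst snd].
  destruct He; subst eps; field; repeat split; auto; intros Z; apply HW; nra.
Qed.

Section Divergence.
Variables (D : R * R -> Prop) (eps : R) (delta dx dy sigma Cx Cy u : R -> R -> R).
Hypothesis Ho : open D.
Hypothesis Hdelta : has_C1 D delta dx dy.
Hypothesis HC : has_C1 D (calabi delta sigma) Cx Cy.
Hypothesis Hu : Ck 2 D u.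
Let a := slope_x eps delta sigma u.
Let b := slope_y eps delta sigma u.
Let W := area_sq eps delta sigma u.
Let ax x y := Dx (Dx u) x y + eps * y * Cx x y.
Let ay x y := Dy (Dx u) x y + eps * (calabi delta sigma x y + y * Cy x y).
Let bx x y := Dy (Dx u) x y - eps * (calabi delta sigma x y + x * Cx x y).
Let b_y x y := Dy (Dy u) x y - eps * x * Cy x y.
Let Wx x y := eps * (2 * delta x y * dx x y * (a x y ^ 2 + b x y ^ 2)
                     + 2 * delta x y ^ 2 * (a x y * ax x y + b x y * bx x y)).
Let Wy x y := eps * (2 * delta x y * dy x y * (a x y ^ 2 + b x y ^ 2)
                     + 2 * delta x y ^ 2 * (a x y * ay x y + b x y * b_y x y)).

Lemma slope_x_C1 : has_C1 D (slope_x eps delta sigma u)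
  (fun x y => Dx (Dx u) x y + eps * y * Cx x y)
  (fun x y => Dy (Dx u) x y + eps * (calabi delta sigma x y + y * Cy x y)).
Proof.
  refine (has_C1_ext D Ho _ _ _ _ _ _ _ _ _
    (has_C1_plus D _ _ _ _ _ _ (Ck_has_C1 D 0 _ (Ck_Dx D 1 u Hu))
      (has_C1_mult D Ho _ _ _ _ _ _
        (has_C1_mult D Ho _ _ _ _ _ _ (has_C1_const D eps) (has_C1_snd D)) HC)));
    intros; unfold slope_x; cbv beta; ring.
Qed.

Lemma slope_y_C1 : has_C1 D (slope_y eps delta sigma u)
  (fun x y => Dy (Dx u) x y - eps * (calabi delta sigma x y + x * Cx x y))
  (fun x y => Dy (Dy u) x y - eps * x * Cy x y).
Proof.
  refine (has_C1_ext D Ho _ _ _ _ _ _ _ _ _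
    (has_C1_plus D _ _ _ _ _ _ (Ck_has_C1 D 0 _ (Ck_Dy D 1 u Hu))
      (has_C1_mult D Ho _ _ _ _ _ _
        (has_C1_mult D Ho _ _ _ _ _ _ (has_C1_const D (- eps)) (has_C1_fst D)) HC)));
    (* Symmetry of the second derivatives puts the mixed one in the order used by [graph_d2]. *)
    intros x y Hp; unfold slope_y; cbv beta; rewrite ?(Ck_mixed D Ho u x y Hu Hp); ring.
Qed.

Lemma area_sq_C1 : has_C1 D (area_sq eps delta sigma u) Wx Wy.
Proof.
  refine (has_C1_ext D Ho _ _ _ _ _ _ _ _ _
    (has_C1_plus D _ _ _ _ _ _ (has_C1_const D 1)
      (has_C1_mult D Ho _ _ _ _ _ _
        (has_C1_mult D Ho _ _ _ _ _ _ (has_C1_const D eps)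
          (has_C1_mult D Ho _ _ _ _ _ _ Hdelta Hdelta))
        (has_C1_plus D _ _ _ _ _ _
          (has_C1_mult D Ho _ _ _ _ _ _ slope_x_C1 slope_x_C1)
          (has_C1_mult D Ho _ _ _ _ _ _ slope_y_C1 slope_y_C1)))));
    intros x y Hp; unfold area_sq; cbv beta; unfold Wx, Wy, a, b, ax, ay, bx, b_y; ring.
Qed.

Hypothesis HW : forall x y, D (x, y) -> 0 < W x y.

(** The quotient rule for [p / sqrt W], with [/ sqrt W] factored out to match
    [trace_second_form_killing]. *)
Lemma flux_C1 p px py : has_C1 D p px py ->
  has_C1 D (fun x y => p x y / sqrt (W x y))
    (fun x y => / sqrt (W x y) * (px x y - p x y * Wx x y / (2 * W x y)))
    (fun x y => / sqrt (W x y) * (py x y - p x y * Wy x y / (2 * W x y))).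
Proof.
  intros Hp.
  assert (Hs : forall x y, D (x, y) -> sqrt (W x y) <> 0)
    by (intros x y Hxy; apply Rgt_not_eq, sqrt_lt_R0; auto).
  refine (has_C1_ext D Ho _ _ _ _ _ _ _ _ _
    (has_C1_mult D Ho _ _ _ _ _ _ Hp
      (has_C1_inv D Ho _ _ _ (has_C1_sqrt D Ho _ _ _ area_sq_C1 HW) Hs)));
  intros x y Hxy; cbv beta; [reflexivity | |];
  fold (W x y); specialize (Hs x y Hxy); assert (HWp := HW x y Hxy);
  assert (E := sqrt_sqrt _ (Rlt_le _ _ HWp));
  set (w := sqrt (W x y)) in *; rewrite <- E; unfold Rdiv; field; auto.
Qed.

Hypothesis Heps : eps = 1 \/ eps = -1.
Hypothesis Hpos : forall x y, D (x, y) -> 0 < delta x y.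

(** The partial derivatives are left arbitrary, which uniqueness of derivatives permits: for a twin
    they are known from the slopes of the other graph rather than from the quotient rule. *)
Lemma mean_curvature_divergence h Fx Fy Gx Gy :
  has_C1 D (fun x y => slope_x eps delta sigma u x y / sqrt (area_sq eps delta sigma u x y))
    Fx Fy ->
  has_C1 D (fun x y => slope_y eps delta sigma u x y / sqrt (area_sq eps delta sigma u x y))
    Gx Gy ->
  has_mean_curvature eps (killing_metric eps delta sigma) D u h <->
  forall x y, D (x, y) -> delta x y ^ 2 * (Fx x y + Gy x y) = 2 * h x y.
Proof.
  intros HF HG.
  assert (E : forall x y, D (x, y) -> forall N,
    upward_unit_normal eps (killing_metric eps delta sigma) u x y N ->
    trace_wrt (first_form (killing_metric eps delta sigma) u x y)
      (second_form eps (killing_metric eps delta sigma) u x y N)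
    = delta x y ^ 2 * (Fx x y + Gy x y)).
  { intros x y Hp N HN; assert (HWp := HW x y Hp).
    apply upward_unit_normal_killing in HN; auto; subst N.
    rewrite (trace_second_form_killing eps delta sigma u x y (dx x y) (dy x y) (Cx x y) (Cy x y));
      auto; try (apply has_C1_differentiable with D; auto);
      try (apply Rgt_not_eq, Hpos; exact Hp); try (apply Rgt_not_eq; exact HWp).
    assert (EF := eq_trans (eq_sym (has_C1_Dx D _ _ _ x y HF Hp))
      (has_C1_Dx D _ _ _ x y (flux_C1 _ _ _ slope_x_C1) Hp)).
    assert (EG := eq_trans (eq_sym (has_C1_Dy D _ _ _ x y HG Hp))
      (has_C1_Dy D _ _ _ x y (flux_C1 _ _ _ slope_y_C1) Hp)).
    cbv beta in EF, EG; rewrite EF, EG.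
    unfold Wx, Wy, a, b, W, ax, ay, bx, b_y; unfold Rdiv; ring. }
  split.
  - intros Hm x y Hp; destruct (Hm x y Hp) as (N & HN & HT).
    rewrite (E x y Hp N HN) in HT; lra.
  - intros Hdiv x y Hp.
    assert (HN := proj2 (upward_unit_normal_killing eps delta sigma u x y _ Heps (Hpos x y Hp)
      (HW x y Hp)) eq_refl).
    eexists; split; [exact HN|]; rewrite (E x y Hp _ HN), (Hdiv x y Hp); field.
Qed.

End Divergence.

(** * Twin correspondence *)

(** With W = w^2, the left side is 1 - eps d^2 (a^2 + b^2) / W = (W - (W - 1)) / W = 1 / W. *)
Lemma twin_area eps d a b w :
  eps ^ 2 = 1 -> 0 < w -> w * w = 1 + eps * d ^ 2 * (a ^ 2 + b ^ 2) ->
  1 + - eps * d ^ 2 * ((- eps * (b / w)) ^ 2 + (eps * (a / w)) ^ 2) = (/ w) ^ 2.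
Proof.
  intros He Hw E.
  replace ((- eps * (b / w)) ^ 2 + (eps * (a / w)) ^ 2)
    with (eps ^ 2 * (a ^ 2 + b ^ 2) / (w * w)) by (field; lra).
  rewrite He.
  apply Rmult_eq_reg_r with (w * w); [|nra].
  replace ((1 + - eps * d ^ 2 * (1 * (a ^ 2 + b ^ 2) / (w * w))) * (w * w))
    with (w * w - eps * d ^ 2 * (a ^ 2 + b ^ 2)) by (field; lra).
  replace ((/ w) ^ 2 * (w * w)) with 1 by (field; lra).
  lra.
Qed.

Lemma area_sq_twin eps eps' delta sigma tau u v x y :
  eps = 1 \/ eps = -1 -> eps' = - eps -> 0 < area_sq eps delta sigma u x y ->
  slope_x eps' delta tau v x y
    = - eps * (slope_y eps delta sigma u x y / sqrt (area_sq eps delta sigma u x y)) ->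
  slope_y eps' delta tau v x y
    = eps * (slope_x eps delta sigma u x y / sqrt (area_sq eps delta sigma u x y)) ->
  area_sq eps' delta tau v x y = (/ sqrt (area_sq eps delta sigma u x y)) ^ 2.
Proof.
  intros He -> HW E1 E2; unfold area_sq at 1; rewrite E1, E2.
  apply twin_area.
  - destruct He; subst; ring.
  - now apply sqrt_lt_R0.
  - rewrite sqrt_sqrt by lra; reflexivity.
Qed.

Lemma sqrt_inv_sqr w : 0 < w -> sqrt ((/ w) ^ 2) = / w.
Proof.
  intros Hw; rewrite <- Rsqr_pow2; apply sqrt_Rsqr; left; now apply Rinv_0_lt_compat.
Qed.

(** Both directions at once: [eps = 1] goes from [E3] to [L3] and [eps = -1] back, with bundle
    curvature and mean curvature exchanging roles. *)
Lemma twin_exists D eps eps' delta dx dy sigma h Cx Cy Kx Ky u :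
  open D -> simply_connected D -> eps = 1 \/ eps = -1 -> eps' = - eps ->
  has_C1 D delta dx dy -> (forall x y, D (x, y) -> 0 < delta x y) ->
  has_C1 D (calabi delta sigma) Cx Cy ->
  (forall x y, D (x, y) ->
     2 * calabi delta sigma x y + x * Cx x y + y * Cy x y = 2 * sigma x y / delta x y ^ 2) ->
  has_C1 D (calabi delta h) Kx Ky ->
  (forall x y, D (x, y) ->
     2 * calabi delta h x y + x * Kx x y + y * Ky x y = 2 * h x y / delta x y ^ 2) ->
  Ck 2 D u -> (forall x y, D (x, y) -> 0 < area_sq eps delta sigma u x y) ->
  has_mean_curvature eps (killing_metric eps delta sigma) D u h ->
  exists v, Ck 2 D v /\
    has_mean_curvature eps' (killing_metric eps' delta h) D v sigma /\
    forall x y, D (x, y) ->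
      slope_x eps' delta h v x y
        = - eps * (slope_y eps delta sigma u x y / sqrt (area_sq eps delta sigma u x y)) /\
      slope_y eps' delta h v x y
        = eps * (slope_x eps delta sigma u x y / sqrt (area_sq eps delta sigma u x y)).
Proof.
  intros Ho Hsc He He' Hd Hpos HC EC HK EK Hu HW Hmc.
  assert (He2 : eps * eps = 1) by (destruct He; subst; ring).
  assert (Ha := slope_x_C1 D eps delta sigma Cx Cy u Ho HC Hu).
  assert (Hb := slope_y_C1 D eps delta sigma Cx Cy u Ho HC Hu).
  assert (HFx : exists Fx Fy, has_C1 D
    (fun x y => slope_x eps delta sigma u x y / sqrt (area_sq eps delta sigma u x y)) Fx Fy)
    by (do 2 eexists; exact (flux_C1 D eps delta dx dy sigma Cx Cy u Ho Hd HC Hu HW _ _ _ Ha)).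
  assert (HGx : exists Gx Gy, has_C1 D
    (fun x y => slope_y eps delta sigma u x y / sqrt (area_sq eps delta sigma u x y)) Gx Gy)
    by (do 2 eexists; exact (flux_C1 D eps delta dx dy sigma Cx Cy u Ho Hd HC Hu HW _ _ _ Hb)).
  destruct HFx as (Fx & Fy & HF), HGx as (Gx & Gy & HG).
  assert (Hdiv := proj1 (mean_curvature_divergence D eps delta dx dy sigma Cx Cy u Ho Hd HC Hu HW
    He Hpos h _ _ _ _ HF HG) Hmc).
  (* The required slopes of [v] are solved for its partial derivatives; as [eps' = - eps], the
     Calabi terms of [h] appear with sign [eps] in the first and [- eps] in the second. *)
  assert (HP := has_C1_plus D _ _ _ _ _ _
    (has_C1_mult D Ho _ _ _ _ _ _ (has_C1_const D (- eps)) HG)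
    (has_C1_mult D Ho _ _ _ _ _ _ (has_C1_const D eps)
      (has_C1_mult D Ho _ _ _ _ _ _ (has_C1_snd D) HK))).
  assert (HQ := has_C1_plus D _ _ _ _ _ _
    (has_C1_mult D Ho _ _ _ _ _ _ (has_C1_const D eps) HF)
    (has_C1_mult D Ho _ _ _ _ _ _ (has_C1_const D (- eps))
      (has_C1_mult D Ho _ _ _ _ _ _ (has_C1_fst D) HK))).
  destruct (poincare D _ _ _ _ _ _ Ho Hsc HP HQ) as (v & Hv).
  { intros x y Hp; cbv beta; specialize (Hdiv x y Hp); specialize (EK x y Hp).
    specialize (Hpos x y Hp).
    assert (E : Fx x y + Gy x y = 2 * calabi delta h x y + x * Kx x y + y * Ky x y).
    { rewrite EK, <- Hdiv; field; lra. }
    apply Rminus_diag_uniq.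
    (* The failure of closedness is [eps] times the mean curvature divergence of [u] minus the
       Calabi divergence of [h]; both equal [2 * h / delta ^ 2]. *)
    transitivity (eps * (Fx x y + Gy x y - (2 * calabi delta h x y + x * Kx x y + y * Ky x y)));
      [ring | rewrite E; ring]. }
  exists v.
  assert (Hv2 : Ck 2 D v).
  { apply (has_C1_Ck D Ho 1 _ _ _ Hv).
    - exact (has_C1_Ck_1 D Ho _ _ _ HP).
    - exact (has_C1_Ck_1 D Ho _ _ _ HQ). }
  assert (Hs : forall x y, D (x, y) ->
      slope_x eps' delta h v x y
        = - eps * (slope_y eps delta sigma u x y / sqrt (area_sq eps delta sigma u x y)) /\
      slope_y eps' delta h v x y
        = eps * (slope_x eps delta sigma u x y / sqrt (area_sq eps delta sigma u x y))).
  { intros x y Hp; unfold slope_x at 1, slope_y at 2.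
    rewrite (has_C1_Dx D _ _ _ x y Hv Hp), (has_C1_Dy D _ _ _ x y Hv Hp), He'.
    split; ring. }
  split; [exact Hv2|split; [|exact Hs]].
  assert (Hw := fun x y Hp => sqrt_lt_R0 _ (HW x y Hp)).
  assert (HA : forall x y, D (x, y) ->
    area_sq eps' delta h v x y = (/ sqrt (area_sq eps delta sigma u x y)) ^ 2).
  { intros x y Hp; apply area_sq_twin; auto; apply Hs; auto. }
  assert (HW' : forall x y, D (x, y) -> 0 < area_sq eps' delta h v x y).
  { intros x y Hp; rewrite HA by auto; apply pow_lt, Rinv_0_lt_compat; auto. }
  (* The area factor of [v] is [/ w], so dividing its slopes by it cancels the division by [w]: the
     flux of [v] is the slope field of [u] turned by a right angle. *)
  assert (HF' : has_C1 D
    (fun x y => slope_x eps' delta h v x y / sqrt (area_sq eps' delta h v x y))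
    (fun x y => - eps * (Dy (Dx u) x y - eps * (calabi delta sigma x y + x * Cx x y)))
    (fun x y => - eps * (Dy (Dy u) x y - eps * x * Cy x y))).
  { refine (has_C1_ext D Ho _ _ _ _ _ _ _ _ _
      (has_C1_mult D Ho _ _ _ _ _ _ (has_C1_const D (- eps)) Hb));
      intros x y Hp; cbv beta; [|ring|ring].
    rewrite (proj1 (Hs x y Hp)), HA, sqrt_inv_sqr by auto.
    specialize (Hw x y Hp); field; lra. }
  assert (HG' : has_C1 D
    (fun x y => slope_y eps' delta h v x y / sqrt (area_sq eps' delta h v x y))
    (fun x y => eps * (Dx (Dx u) x y + eps * y * Cx x y))
    (fun x y => eps * (Dy (Dx u) x y + eps * (calabi delta sigma x y + y * Cy x y)))).
  { refine (has_C1_ext D Ho _ _ _ _ _ _ _ _ _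
      (has_C1_mult D Ho _ _ _ _ _ _ (has_C1_const D eps) Ha));
      intros x y Hp; cbv beta; [|ring|ring].
    rewrite (proj2 (Hs x y Hp)), HA, sqrt_inv_sqr by auto.
    specialize (Hw x y Hp); field; lra. }
  assert (Heps' : eps' = 1 \/ eps' = -1) by (destruct He; subst; [right | left]; lra).
  apply (mean_curvature_divergence D eps' delta dx dy h Kx Ky v Ho Hd HK Hv2 HW' Heps' Hpos
    sigma _ _ _ _ HF' HG').
  intros x y Hp; cbv beta; specialize (EC x y Hp); specialize (Hpos x y Hp).
  (* The mixed second derivatives of [u] cancel in this curl, and the Calabi terms of [sigma]
     combine with the sign [eps * eps = 1]. *)
  transitivity (delta x y ^ 2 * (eps * eps
    * (2 * calabi delta sigma x y + x * Cx x y + y * Cy x y))); [ring|].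
  rewrite He2, EC; field; lra.
Qed.

(** The induced form is [1 / delta ^ 2] times the Euclidean one minus the square of the linear form
    with coefficients (a, b); its smallest eigenvalue, attained along (a, b), is
    [area_sq / delta ^ 2]. *)
Lemma spacelike_area delta h D g :
  (forall x y, D (x, y) -> 0 < delta x y) ->
  spacelike (L3 delta h) D g <-> forall x y, D (x, y) -> 0 < area_sq (-1) delta h g x y.
Proof.
  intros Hpos.
  assert (E : forall x y V, D (x, y) -> first_form (L3 delta h) g x y V V = 1 / delta x y ^ 2 *
     (fst V ^ 2 + snd V ^ 2 - delta x y ^ 2 *
       (slope_x (-1) delta h g x y * fst V + slope_y (-1) delta h g x y * snd V) ^ 2)).
  { intros x y V Hp; specialize (Hpos x y Hp); unfold L3; rewrite first_form_killing.
    field; lra. }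
  assert (Hi : forall x y, D (x, y) -> 0 < 1 / delta x y ^ 2).
  { intros x y Hp; apply Rdiv_lt_0_compat; [lra | apply pow_lt; auto]. }
  split; intros H x y Hp.
  - unfold area_sq; set (a := slope_x (-1) delta h g x y); set (b := slope_y (-1) delta h g x y).
    (* The test vector is (a, b); when it vanishes, the area factor is 1. *)
    destruct (Req_dec (a ^ 2 + b ^ 2) 0) as [Z|Z]; [rewrite Z; lra|].
    assert (Hr : 0 < a ^ 2 + b ^ 2) by (assert (A := pow2_ge_0 a); assert (B := pow2_ge_0 b); lra).
    assert (HV : (a, b) <> (0, 0)) by (intros Q; injection Q as Qa Qb; rewrite Qa, Qb in Z; lra).
    specialize (H x y Hp _ HV); rewrite E in H by auto; cbn [fst snd] in H; fold a b in H.
    apply Rmult_lt_reg_l with (a ^ 2 + b ^ 2); auto.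
    rewrite Rmult_0_r; apply Rmult_lt_reg_l with (1 / delta x y ^ 2); [now apply Hi|].
    rewrite Rmult_0_r.
    match type of H with 0 < ?X => match goal with |- 0 < ?Y => replace Y with X; auto end end.
    ring.
  - intros [v1 v2] HV; rewrite E by auto; cbn [fst snd].
    specialize (H x y Hp); unfold area_sq in H.
    set (a := slope_x (-1) delta h g x y) in *; set (b := slope_y (-1) delta h g x y) in *.
    set (d := delta x y) in *.
    assert (Hv : 0 < v1 ^ 2 + v2 ^ 2).
    { destruct (Req_dec v1 0) as [Z1|Z1]; [destruct (Req_dec v2 0) as [Z2|Z2]|].
      - subst; tauto.
      - assert (A := pow2_gt_0 v2 Z2); assert (B := pow2_ge_0 v1); lra.
      - assert (A := pow2_gt_0 v1 Z1); assert (B := pow2_ge_0 v2); lra. }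
    apply Rmult_lt_0_compat; [now apply Hi|].
    (* Cauchy--Schwarz *)
    replace (v1 ^ 2 + v2 ^ 2 - d ^ 2 * (a * v1 + b * v2) ^ 2)
      with ((1 + -1 * d ^ 2 * (a ^ 2 + b ^ 2)) * (v1 ^ 2 + v2 ^ 2)
            + d ^ 2 * (a * v2 - b * v1) ^ 2) by ring.
    assert (A := Rmult_lt_0_compat _ _ H Hv).
    assert (B := Rmult_le_pos _ _ (pow2_ge_0 d) (pow2_ge_0 (a * v2 - b * v1))); lra.
Qed.

(** * The twin relation and conformality *)

Lemma alpha_slope delta tau f x y : alpha delta tau f x y = slope_x 1 delta tau f x y.
Proof. unfold alpha, slope_x; ring. Qed.

Lemma beta_slope delta tau f x y : beta delta tau f x y = slope_y 1 delta tau f x y.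
Proof. unfold beta, slope_y; ring. Qed.

Lemma omega_area delta tau f x y : omega delta tau f x y = sqrt (area_sq 1 delta tau f x y).
Proof. unfold omega, area_sq; rewrite alpha_slope, beta_slope; f_equal; ring. Qed.

Lemma alpha'_slope delta h g x y : alpha' delta h g x y = slope_x (-1) delta h g x y.
Proof. unfold alpha', slope_x; ring. Qed.

Lemma beta'_slope delta h g x y : beta' delta h g x y = slope_y (-1) delta h g x y.
Proof. unfold beta', slope_y; ring. Qed.

Lemma omega'_area delta h g x y : omega' delta h g x y = sqrt (area_sq (-1) delta h g x y).
Proof. unfold omega', area_sq; rewrite alpha'_slope, beta'_slope; f_equal; ring. Qed.

Lemma area_sq_1_pos delta tau f x y : 0 < area_sq 1 delta tau f x y.
Proof.
  unfold area_sq; set (a := slope_x _ _ _ _ _ _); set (b := slope_y _ _ _ _ _ _).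
  assert (A := pow2_ge_0 a); assert (B := pow2_ge_0 b).
  assert (C := Rmult_le_pos _ _ (pow2_ge_0 (delta x y)) (Rplus_le_le_0_compat _ _ A B)); lra.
Qed.

(** With [eps = 1] this is the first twin relation and with [eps = -1] the inverse one, so that
    their equivalence becomes a symmetry. *)
Definition twin_at (eps : R) (delta sigma u : R -> R -> R) (eps' : R) (h v : R -> R -> R)
    (x y : R) : Prop :=
  slope_x eps' delta h v x y
    = - eps * (slope_y eps delta sigma u x y / sqrt (area_sq eps delta sigma u x y)) /\
  slope_y eps' delta h v x y
    = eps * (slope_x eps delta sigma u x y / sqrt (area_sq eps delta sigma u x y)).

(** The two area factors are inverse to each other and the two quarter turns, of signs [eps] and
    [- eps], undo each other. *)
Lemma twin_at_sym eps eps' delta sigma u h v x y :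
  eps = 1 \/ eps = -1 -> eps' = - eps -> 0 < area_sq eps delta sigma u x y ->
  twin_at eps delta sigma u eps' h v x y -> twin_at eps' delta h v eps sigma u x y.
Proof.
  intros He He' HW [E1 E2]; unfold twin_at.
  rewrite (area_sq_twin eps eps' delta sigma h u v x y He He' HW E1 E2).
  assert (Hs := sqrt_lt_R0 _ HW); rewrite sqrt_inv_sqr by auto.
  rewrite E1, E2, He'.
  split; destruct He; subst; field; lra.
Qed.

Lemma twin_iff delta tau H f g D :
  twin delta tau H f g D <->
  forall x y, D (x, y) -> twin_at 1 delta tau f (-1) H g x y.
Proof.
  unfold twin, twin_at; split; intros T x y Hp; specialize (T x y Hp).
  - rewrite alpha'_slope, beta'_slope, alpha_slope, beta_slope, omega_area in T.
    injection T as T1 T2; rewrite T1, T2; split; ring.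
  - destruct T as [T1 T2].
    rewrite alpha'_slope, beta'_slope, alpha_slope, beta_slope, omega_area, T1, T2.
    f_equal; ring.
Qed.

Lemma twin_inv_iff delta tau H f g D :
  twin_inv delta tau H f g D <->
  forall x y, D (x, y) -> twin_at (-1) delta H g 1 tau f x y.
Proof.
  unfold twin_inv, twin_at; split; intros T x y Hp; specialize (T x y Hp).
  - rewrite alpha'_slope, beta'_slope, alpha_slope, beta_slope, omega'_area in T.
    injection T as T1 T2; rewrite T1, T2; split; ring.
  - destruct T as [T1 T2].
    rewrite alpha'_slope, beta'_slope, alpha_slope, beta_slope, omega'_area, T1, T2.
    f_equal; ring.
Qed.

Lemma twin_omega delta tau H f g x y :
  twin_at 1 delta tau f (-1) H g x y -> omega' delta H g x y = / omega delta tau f x y.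
Proof.
  intros [T1 T2]; rewrite omega'_area, omega_area.
  rewrite (area_sq_twin 1 (-1) delta tau H f g x y (or_introl eq_refl) ltac:(ring)
    (area_sq_1_pos _ _ _ _ _) T1 T2).
  apply sqrt_inv_sqr, sqrt_lt_R0, area_sq_1_pos.
Qed.

Lemma omega_pos delta tau f x y : 0 < omega delta tau f x y.
Proof. rewrite omega_area; apply sqrt_lt_R0, area_sq_1_pos. Qed.

(** For the slope vector s of [f] and its quarter turn Js, the products (s.V)(s.W) and (Js.V)(Js.W)
    add up to |s|^2 (V.W). Hence w^2 I_G - I_F is a multiple of w^2 - 1 - d^2 |s|^2 = 0. *)
Lemma twin_first_form delta tau H f g x y V W :
  0 < delta x y -> twin_at 1 delta tau f (-1) H g x y ->
  first_form (L3 delta H) g x y V W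
  = 1 / omega delta tau f x y ^ 2 * first_form (E3 delta tau) f x y V W.
Proof.
  intros Hd [T1 T2]; unfold L3, E3.
  assert (Hw := omega_pos delta tau f x y).
  rewrite !first_form_killing, T1, T2; rewrite <- omega_area.
  assert (E : omega delta tau f x y * omega delta tau f x y = area_sq 1 delta tau f x y).
  { rewrite omega_area; apply sqrt_sqrt; left; apply area_sq_1_pos. }
  unfold area_sq in E.
  set (a := slope_x 1 delta tau f x y) in *; set (b := slope_y 1 delta tau f x y) in *.
  set (w := omega delta tau f x y) in *; set (d := delta x y) in *; clearbody a b w d.
  destruct V as [v1 v2], W as [w1 w2]; cbn [fst snd].
  apply Rminus_diag_uniq.
  match goal with |- ?X = 0 => transitivity
    ((v1 * w1 + v2 * w2) * (w * w - (1 + 1 * d ^ 2 * (a ^ 2 + b ^ 2))) / (d ^ 2 * w ^ 2)) end.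
  - field; lra.
  - rewrite E; field; lra.
Qed.

(** A chart map is controlled only over [D], so its derivatives are obtained from those of the
    identity through openness of [D]. *)
Lemma identity_chart (D : R * R -> Prop) (phi : R -> R -> R * R) :
  open D -> (forall x y, D (x, y) -> phi x y = (x, y)) ->
  C2_map D phi /\ forall x y, D (x, y) -> forall V, map_d phi x y V = V.
Proof.
  intros Ho E.
  assert (H1 : has_C1 D (fun x y => fst (phi x y)) (fun _ _ => 1) (fun _ _ => 0)).
  { refine (has_C1_ext D Ho _ _ _ _ _ _ _ _ _ (has_C1_fst D)); auto.
    intros x y Hp; now rewrite E. }
  assert (H2 : has_C1 D (fun x y => snd (phi x y)) (fun _ _ => 0) (fun _ _ => 1)).
  { refine (has_C1_ext D Ho _ _ _ _ _ _ _ _ _ (has_C1_snd D)); auto.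
    intros x y Hp; now rewrite E. }
  assert (Hc : forall c, Ck 1 D (fun _ _ => c))
    by (intros c; exact (has_C1_Ck_1 D Ho _ _ _ (has_C1_const D c))).
  split.
  - split; eapply (has_C1_Ck D Ho 1); eauto; apply Hc.
  - intros x y Hp [v1 v2]; unfold map_d.
    rewrite (has_C1_Dx D _ _ _ x y H1 Hp), (has_C1_Dy D _ _ _ x y H1 Hp),
      (has_C1_Dx D _ _ _ x y H2 Hp), (has_C1_Dy D _ _ _ x y H2 Hp); cbn [fst snd].
    f_equal; ring.
Qed.

Lemma has_C1_subset (D D' : R * R -> Prop) u ux uy :
  (forall p, D' p -> D p) -> has_C1 D u ux uy -> has_C1 D' u ux uy.
Proof. intros HD Hu x y Hp; apply Hu, HD, Hp. Qed.

Theorem theorem5 :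
  forall (Omega : R * R -> Prop) (delta tau H : R -> R -> R) (Omega' : R * R -> Prop),
    open Omega -> star_shaped Omega ->
    smooth Omega delta -> (forall x y, Omega (x, y) -> 0 < delta x y) ->
    Ck 2 Omega tau -> Ck 2 Omega H ->
    open Omega' -> simply_connected Omega' -> (forall p, Omega' p -> Omega p) ->
    (forall f,
       Ck 2 Omega' f ->
       has_mean_curvature 1 (E3 delta tau) Omega' f H ->
       exists g,
         Ck 2 Omega' g /\ spacelike (L3 delta H) Omega' g /\
         has_mean_curvature (-1) (L3 delta H) Omega' g tau /\
         twin delta tau H f g Omega') /\
    (forall g,
       Ck 2 Omega' g -> spacelike (L3 delta H) Omega' g ->
       has_mean_curvature (-1) (L3 delta H) Omega' g tau ->
       exists f,
         Ck 2 Omega' f /\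
         has_mean_curvature 1 (E3 delta tau) Omega' f H /\
         twin delta tau H f g Omega') /\
    (forall f g,
       Ck 2 Omega' f -> Ck 2 Omega' g -> spacelike (L3 delta H) Omega' g ->
       (twin delta tau H f g Omega' <-> twin_inv delta tau H f g Omega') /\
       (twin delta tau H f g Omega' ->
        (forall Phi : space -> space,
           (forall x y, Omega' (x, y) -> Phi (graph f x y) = graph g x y) ->
           conformal_diffeomorphism Omega' (E3 delta tau) f (L3 delta H) g Phi) /\
        (forall x y, Omega' (x, y) -> forall V W : R * R,
           let I_F := first_form (E3 delta tau) f x y V W in
           let I_G := first_form (L3 delta H) g x y V W in
           I_G = 1 / omega delta tau f x y ^ 2 * I_F /\
           I_F = 1 / omega' delta H g x y ^ 2 * I_G /\
           1 / omega delta tau f x y * I_F = 1 / omega' delta H g x y * I_G))).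
Proof.
  intros Omega delta tau H Omega' HoO Hstar Hdelta HposO Htau HH Ho Hsc Hsub.
  assert (Hpos : forall x y, Omega' (x, y) -> 0 < delta x y) by auto.
  assert (Hd := has_C1_subset _ _ _ _ _ Hsub (Ck_has_C1 Omega 1 delta (Hdelta 2%nat))).
  destruct (calabi_C1 Omega delta tau HoO Hstar Hdelta HposO Htau) as (Tx & Ty & HT & ET).
  destruct (calabi_C1 Omega delta H HoO Hstar Hdelta HposO HH) as (Kx & Ky & HK & EK).
  apply has_C1_subset with (1 := Hsub) in HT; apply has_C1_subset with (1 := Hsub) in HK.
  assert (ET' := fun x y Hp => ET x y (Hsub _ Hp)).
  assert (EK' := fun x y Hp => EK x y (Hsub _ Hp)).
  clear ET EK.
  split; [|split].
  - intros f Hf Hmc.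
    destruct (twin_exists Omega' 1 (-1) delta (Dx delta) (Dy delta) tau H Tx Ty Kx Ky f)
      as (g & Hg & Hm & Ht);
      auto; [intros; apply area_sq_1_pos |].
    exists g; split; [exact Hg|split; [|split; [exact Hm|]]].
    + apply spacelike_area; auto; intros x y Hp; destruct (Ht x y Hp) as [T1 T2].
      rewrite (area_sq_twin 1 (-1) delta tau H f g x y (or_introl eq_refl) ltac:(ring)
        (area_sq_1_pos _ _ _ _ _) T1 T2).
      apply pow_lt, Rinv_0_lt_compat, sqrt_lt_R0, area_sq_1_pos.
    + apply twin_iff; exact Ht.
  - intros g Hg Hsp Hmc.
    assert (HW := proj1 (spacelike_area delta H Omega' g Hpos) Hsp).
    destruct (twin_exists Omega' (-1) 1 delta (Dx delta) (Dy delta) H tau Kx Ky Tx Ty g)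
      as (f & Hf & Hm & Ht);
      auto; [ring|].
    exists f; split; [exact Hf|split; [exact Hm|]].
    (* The construction yields the slopes of [f] from those of [g]; symmetry reverses the
       relation. *)
    apply twin_iff; intros x y Hp; apply twin_at_sym; auto; try ring; exact (Ht x y Hp).
  - intros f g Hf Hg Hsp.
    assert (HW := proj1 (spacelike_area delta H Omega' g Hpos) Hsp).
    split.
    + rewrite twin_iff, twin_inv_iff; split; intros T x y Hp; apply twin_at_sym; auto;
        try apply area_sq_1_pos; ring.
    + intros T; rewrite twin_iff in T; split.
      * intros Phi HPhi.
        assert (HC : forall x y, Omega' (x, y) -> chart_map Phi f x y = (x, y))
          by (intros x y Hp; unfold chart_map; now rewrite HPhi).
        destruct (identity_chart Omega' _ Ho HC) as [C1 C2].
        split; [|split].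
        -- intros q (x & y & Hp & ->); exists x, y; auto.
        -- exists (fun q => graph f (fst (fst q)) (snd (fst q))).
           split; [|split; [|split; [|split]]].
           ++ intros q (x & y & Hp & ->); exists x, y; auto.
           ++ intros q (x & y & Hp & ->); now rewrite HPhi.
           ++ intros q (x & y & Hp & ->); simpl; now rewrite HPhi.
           ++ exact C1.
           ++ apply identity_chart; auto.
        -- exists (fun q => 1 / omega delta tau f (fst (fst q)) (snd (fst q)) ^ 2); split.
           ++ intros q _; apply Rdiv_lt_0_compat; [lra | apply pow_lt, omega_pos].
           ++ intros x y Hp V W; cbv zeta; rewrite !C2, HC by auto.
              now apply twin_first_form; auto.
      * intros x y Hp V W; cbv zeta.
        assert (Hw := omega_pos delta tau f x y).
        rewrite (twin_first_form delta tau H f g x y V W (Hpos x y Hp) (T x y Hp)).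
        rewrite (twin_omega delta tau H f g x y (T x y Hp)).
        split; [reflexivity | split; field; lra].
Qed.
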